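(* Let $\alpha\in(0,1)$ and $T>0$, let $G\subset\mathbb{R}^d$ ($d\ge1$) be a (bounded) Lipschitz domain and $G_0\subset G$ a measurable subset of positive Lebesgue measure. Let $\xi$ be an absolutely continuous real random variable on a probability space $(\Omega,\mathcal{F},\mathbb{P})$. Then the system $$\partial^{\alpha}_{0,t}y-\xi\,\mathrm{i}\,\Delta y=\mathds{1}_{G_0}u\ \text{ in }(0,T)\times G,\qquad y=0\ \text{ on }(0,T)\times\partial G,\qquad y(0,\cdot)=y_0\ \text{ in }G,$$ is not exactly averaged controllable in $L^2(G)$ with controls acting in $L^\infty((0,T)\times G_0)$.
   Context: $\xi$ is absolutely continuous if its law has a density: there is a nonnegative $\rho_\xi\in L^1(\mathbb{R})$ with $\mathbb{P}[\xi\in\mathscr{A}]=\int_{\mathscr{A}}\rho_\xi(x)\,\mathrm{d}x$ for all Borel $\mathscr{A}\subset\mathbb{R}$. $L^2(G)=L^2(G;\mathbb{C})$ with its Hermitian inner product $\langle\cdot,\cdot\rangle$. $\{\lambda_n\}_{n\in\mathbb{N}}$ (with $\mathbb N=\{0,1,2,\dots\}$) are the eigenvalues of the Dirichlet Laplacian $-\Delta$ on $G$, with $0<\lambda_0\le\lambda_1\le\cdots\to\infty$, and $\{e_n\}_{n\in\mathbb{N}}$ is a corresponding Hilbert basis of $L^2(G)$ of eigenfunctions. $\partial^{\alpha}_{0,t}y(t)=\frac{1}{\Gamma(1-\alpha)}\int_0^t(t-\tau)^{-\alpha}\partial_\tau y(\tau)\,\mathrm{d}\tau$ is the Caputo derivative.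 $\mathds{1}_{G_0}$ is the indicator function of $G_0$. $E_{\alpha,\beta}(z)=\sum_{n=0}^{\infty}\frac{z^n}{\Gamma(\alpha n+\beta)}$ is the Mittag--Leffler function. For each real value of $\xi$, the solution of the system is given by $$y(t,\cdot;\xi;y_0;u)=\sum_{n=0}^{\infty}\left[\langle y_0,e_n\rangle E_{\alpha,1}(-\mathrm{i}\xi\lambda_nt^\alpha)+\int_0^t\langle\mathds{1}_{G_0}u(s,\cdot),e_n\rangle(t-s)^{\alpha-1}E_{\alpha,\alpha}(-\mathrm{i}\xi\lambda_n(t-s)^\alpha)\,\mathrm{d}s\right]e_n ,$$ and $\mathbb{E}$ denotes expectation with respect to $\xi=\xi(\omega)$; the data $y_0$ and the control $u$ do not depend on $\omega$. Definition. The system is exactly averaged controllable in $L^2(G)$ (with control cost $\mathscr{C}_{ex}$) if there is a constant $\mathscr{C}_{ex}=\mathscr{C}_{ex}(G,G_0,\xi,T)>0$ such that for all $y_0,y_1\in L^2(G)$ there exists a control $u\in L^\infty((0,T)\times G_0)$ with $\|u\|_{L^\infty((0,T)\times G_0)}\le\mathscr{C}_{ex}(\|y_0\|_{L^2(G)}+\|y_1\|_{L^2(G)})$ and $\mathbb{E}(y(T,\cdot;\xi;y_0;u))=y_1$. *)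

(* Defs.v *)
From HB Require Import structures.
From mathcomp Require Import all_boot all_order all_algebra.
From mathcomp.real_closed Require Import complex.
From mathcomp Require Import all_classical all_reals all_analysis.
From mathcomp Require Import measurable_realfun ess_sup_inf.
Set Implicit Arguments. Unset Strict Implicit. Unset Printing Implicit Defensive.
Import Order.TTheory GRing.Theory Num.Theory.
Import numFieldNormedType.Exports.
Local Open Scope classical_set_scope.
Local Open Scope ring_scope.
Local Open Scope complex_scope.

(* R^n is the normed space 'rV[R]_n, here with the sigma-algebra generated by the
   coordinates, that is, the Borel sigma-algebra. *)
Fact row_display : measure_display. Proof. exact: default_measure_display. Qed.

Section borel.
Variables (R : realType) (n : nat).

Definition coord (i : 'I_n) (x : 'rV[R]_n) : R := x ord0 i.

Let row_set0 : g_sigma_preimage coord set0.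
Proof. exact: sigma_algebra0. Qed.
Let row_setC A : g_sigma_preimage coord A -> g_sigma_preimage coord (~` A).
Proof. exact: sigma_algebraC. Qed.
Let row_bigcup (F : _^nat) : (forall i, g_sigma_preimage coord (F i)) ->
  g_sigma_preimage coord (\bigcup_i (F i)).
Proof. exact: sigma_algebra_bigcup. Qed.

HB.instance Definition _ := @isMeasurable.Build row_display
  'rV[R]_n (g_sigma_preimage coord) row_set0 row_setC row_bigcup.

Lemma measurable_coord i : measurable_fun [set: 'rV[R]_n] (coord i).
Proof.
move=> _ Y mY; rewrite setTI; apply: sub_sigma_algebra => /=.
rewrite -bigcup_seq/=; exists i => /=; first by rewrite mem_index_enum.
by exists Y => //; rewrite setTI.
Qed.

Lemma measurable_fun_coordP d (T : measurableType d) (f : T -> 'rV[R]_n) :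
  (forall i, measurable_fun [set: T] (coord i \o f)) <->
  measurable_fun [set: T] f.
Proof.
split=> [mf|mf i]; last exact: (measurableT_comp (measurable_coord i)).
have : g_sigma_preimage (fun i => coord i \o f) `<=` measurable.
  apply: smallest_sub; first exact: sigma_algebra_measurable.
  rewrite -bigcup_seq => A [i _ [B mB <-]]; exact: mf.
by rewrite g_sigma_preimage_comp => prefS _ A mA; apply: prefS; exists A.
Qed.
End borel.

Section lebesgue.
Variable R : realType.

Definition row_cons n (p : R * 'rV[R]_n) : 'rV[R]_n.+1 :=
  row_mx (const_mx p.1 : 'rV_1) p.2.

Definition row_uncons n (v : 'rV[R]_n.+1) : R * 'rV[R]_n :=
  (v ord0 ord0, \row_i v ord0 (lift ord0 i)).

Lemma row_consK n : cancel (@row_cons n) (@row_uncons n).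
Proof.
move=> [x v]; congr pair => /=.
  by rewrite /row_cons mxE; case: splitP => // j _; rewrite mxE.
apply/rowP => i; rewrite !mxE; case: splitP => [j|j] /=.
  by rewrite [j]ord1.
by rewrite /bump !add1n => -[] /val_inj->.
Qed.

Lemma row_unconsK n : cancel (@row_uncons n) (@row_cons n).
Proof.
move=> v; apply/rowP => i; rewrite mxE; case: splitP => j ij; rewrite mxE.
  by congr (v _ _); apply: val_inj; rewrite /= ij [j]ord1.
by congr (v _ _); apply: val_inj; rewrite /= ij.
Qed.

Lemma measurable_row_cons n : measurable_fun [set: _] (@row_cons n).
Proof.
apply/measurable_fun_coordP => i.
case: (@splitP 1 n i) => j ij.
  rewrite (_ : _ \o _ = fst); first exact: measurable_fst.
  apply/funext => p /=; rewrite -[RHS](congr1 fst (row_consK p)) /=.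
  by congr (_ _ _); apply: val_inj; rewrite /= ij [j]ord1.
rewrite (_ : _ \o _ = coord j \o snd).
  exact: measurableT_comp (measurable_coord j) measurable_snd.
apply/funext => p /=; rewrite -[RHS](congr1 (coord j \o snd) (row_consK p)) /=.
by rewrite /coord mxE; congr (_ _ _); apply: val_inj; rewrite /= ij.
Qed.

Lemma measurable_row_uncons n : measurable_fun [set: _] (@row_uncons n).
Proof.
apply: measurable_fun_pair; first exact: measurable_coord.
apply/measurable_fun_coordP => i.
rewrite (_ : _ \o _ = coord (lift ord0 i)); first exact: measurable_coord.
by apply/funext => v; rewrite /= /coord mxE.
Qed.

(* The image of lebesgue_measure \x mu under R * R^n ~ R^(n+1); iterating it gives
   the n-dimensional Lebesgue measure row_lebesgue, see row_lebesgue_box. *)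
Definition row_measureS n (mu : {sigma_finite_measure set 'rV[R]_n -> \bar R}) :=
  pushforward (@lebesgue_measure R \x mu)%E (@row_cons n).

Section row_measureS.
Variables (n : nat) (mu : {sigma_finite_measure set 'rV[R]_n -> \bar R}).

Let row_measureS0 : row_measureS mu set0 = 0%E.
Proof. by rewrite /row_measureS /pushforward preimage_set0 measure0. Qed.

Let row_measureS_ge0 A : (0 <= row_measureS mu A)%E.
Proof. exact: (measure_ge0 (@lebesgue_measure R \x mu)%E). Qed.

Let row_measureS_sigma_additive : semi_sigma_additive (row_measureS mu).
Proof.
exact: (@measure_semi_sigma_additive _ _ _
  (measure_function_pushforward__canonical__measure_function_Measure
    (@lebesgue_measure R \x mu)%E (@measurable_row_cons n))).
Qed.

HB.instance Definition _ := isMeasure.Build _ _ _ (row_measureS mu)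
  row_measureS0 row_measureS_ge0 row_measureS_sigma_additive.

Let row_measureS_sigma_finite : sigma_finite setT (row_measureS mu).
Proof.
have /sigma_finiteP[F [FT ndF Foo]] := sigma_finiteT (@lebesgue_measure R).
have /sigma_finiteP[G [GT ndG Goo]] := sigma_finiteT mu.
exists (fun k => @row_uncons n @^-1` (F k `*` G k)).
  rewrite -preimage_bigcup [X in _ @^-1` X](_ : _ = setT) ?preimage_setT//.
  rewrite -subTset -setXTT FT GT => -[x y] [/= [i _ Fix] [j _ Gjy]].
  exists (maxn i j) => //; split.
    by move: Fix; exact/subsetPset/ndF/leq_maxl.
  by move: Gjy; exact/subsetPset/ndG/leq_maxr.
move=> k; have [[mF Fk] [mG Gk]] := (Foo k, Goo k); split.
  rewrite -[X in measurable X]setTI.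
  by apply: measurable_row_uncons => //; exact: measurableX.
rewrite /row_measureS /pushforward -comp_preimage.
rewrite (_ : _ \o _ = id); last by apply/funext => p /=; rewrite row_consK.
rewrite preimage_id product_measure1E//.
by rewrite lte_mul_pinfty// ge0_fin_numE.
Qed.

HB.instance Definition _ := Measure_isSigmaFinite.Build _ _ _ (row_measureS mu)
  row_measureS_sigma_finite.

End row_measureS.

Fixpoint row_lebesgue n : {sigma_finite_measure set 'rV[R]_n -> \bar R} :=
  if n is m.+1 then row_measureS (row_lebesgue m) else \d_(0 : 'rV[R]_0).

Definition row_box n (a b : 'rV[R]_n) : set 'rV[R]_n :=
  [set x | forall i, a ord0 i <= x ord0 i <= b ord0 i].

Lemma row_cons_ord0 n (p : R * 'rV[R]_n) : row_cons p ord0 ord0 = p.1.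
Proof. by rewrite -[in RHS](row_consK p). Qed.

Lemma row_cons_lift n (p : R * 'rV[R]_n) i :
  row_cons p ord0 (lift ord0 i) = p.2 ord0 i.
Proof. by rewrite -[in RHS](row_consK p) [RHS]mxE. Qed.

Lemma measurable_row_box n (a b : 'rV[R]_n) : measurable (row_box a b).
Proof.
have -> : row_box a b =
    \bigcap_(i in [set: 'I_n]) (coord i @^-1` `[a ord0 i, b ord0 i]).
  apply/seteqP; split => x /= h.
    by move=> i _; rewrite /= in_itv/=; exact: h.
  by move=> i; have := h i I; rewrite /= in_itv.
apply: fin_bigcap_measurable => // i _.
by rewrite -[X in measurable X]setTI; exact: measurable_coord.
Qed.

Lemma row_lebesgue_box n (a b : 'rV[R]_n) : (forall i, a ord0 i <= b ord0 i) ->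
  row_lebesgue n (row_box a b) = (\prod_(i < n) (b ord0 i - a ord0 i))%:E.
Proof.
elim: n => [|n IH] in a b * => ab.
  by rewrite big_ord0 /= diracE mem_set// => -[].
rewrite /= /row_measureS /pushforward big_ord_recl.
pose a' := (row_uncons a).2; pose b' := (row_uncons b).2.
rewrite [X in (_ \x _)%E X](_ : _ = `[a ord0 ord0, b ord0 ord0] `*` row_box a' b').
  rewrite product_measure1E//; last exact: measurable_row_box.
  rewrite IH => [|i]; last by rewrite !mxE.
  rewrite EFinM; congr (_ * _)%E; last first.
    by congr EFin; apply: eq_bigr => i _; rewrite !mxE.
  rewrite -[LHS]/(lebesgue_measure `[a ord0 ord0, b ord0 ord0]%classic).
  rewrite lebesgue_measure_itv/= lte_fin.
  have := ab ord0; rewrite le_eqVlt => /predU1P[->|->//].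
  by rewrite ltxx subrr.
apply/seteqP; split => -[x v] /=.
  move=> h; split; first by have := h ord0; rewrite row_cons_ord0 in_itv.
  by move=> i; have := h (lift ord0 i); rewrite row_cons_lift !mxE.
move=> -[]; rewrite in_itv/= => hx hv i.
case: (unliftP ord0 i) => [j|] ->; last by rewrite row_cons_ord0.
by have := hv j; rewrite row_cons_lift !mxE.
Qed.

End lebesgue.

Section complex_functions.
Variable R : realType.

Definition cmeasurable_fun d (T : measurableType d) (D : set T) (f : T -> R[i]) :=
  measurable_fun D (fun x => complex.Re (f x)) /\
  measurable_fun D (fun x => complex.Im (f x)).

Definition cintegral d (T : measurableType d) (mu : {measure set T -> \bar R})
    (D : set T) (f : T -> R[i]) : R[i] :=
  (\int[mu]_(x in D) complex.Re (f x)) +i* (\int[mu]_(x in D) complex.Im (f x)).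

(* Gamma and mittag_leffler are meant for x, a, b > 0, where the integral and the
   series converge. *)
Definition Gamma (x : R) : R :=
  \int[lebesgue_measure]_(t in `]0, +oo[) (t `^ (x - 1) * expR (- t)).

Definition mittag_leffler_term (a b : R) (z : R[i]) (n : nat) : R[i] :=
  z ^+ n / (Gamma (a * n%:R + b))%:C.

Definition mittag_leffler (a b : R) (z : R[i]) : R[i] :=
  limn (series (fun n => complex.Re (mittag_leffler_term a b z n))) +i*
  limn (series (fun n => complex.Im (mittag_leffler_term a b z n))).

End complex_functions.

(* An element of L^2 is represented by a Borel function. L2norm and L2inner are
   meant for functions in L2: a divergent integral is 0 or junk. Two functions are
   equal in L^2 when the L2norm of their difference is 0. *)
Section L2.
Variables (R : realType) (d : nat) (G : set 'rV[R]_d).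
Implicit Types f g : 'rV[R]_d -> R[i].

Definition L2 f := cmeasurable_fun G f /\
  (\int[row_lebesgue R d]_(x in G) (Normc.normc (f x) ^+ 2)%:E < +oo)%E.

Definition L2norm f : R :=
  Num.sqrt (\int[row_lebesgue R d]_(x in G) (Normc.normc (f x) ^+ 2)).

Definition L2inner f g : R[i] :=
  cintegral (row_lebesgue R d) G (fun x => f x * conjc (g x)).

Definition L2cvg (F : nat -> 'rV[R]_d -> R[i]) f :=
  (fun k => L2norm (fun x => F k x - f x)) @ \oo --> (0 : R).

Definition hilbert_basis (e : nat -> 'rV[R]_d -> R[i]) :=
  [/\ forall n, L2 (e n),
      forall m n, L2inner (e m) (e n) = (m == n)%:R &
      forall f, L2 f -> forall eps, 0 < eps -> exists N (c : nat -> R[i]),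
        L2norm (fun x => f x - \sum_(n < N) c n * e n x) < eps].

End L2.

Section dirichlet_laplacian.
Variables (R : realType) (d : nat) (G : set 'rV[R]_d).

Definition pderiv (i : 'I_d) (f : 'rV[R]_d -> R) : 'rV[R]_d -> R :=
  'D_(delta_mx ord0 i) f.

Definition smooth (f : 'rV[R]_d -> R) := forall s : seq 'I_d,
  continuous (foldr pderiv f s) /\
  forall i x, derivable (foldr pderiv f s) x (delta_mx ord0 i).

(* C_c^oo(G) *)
Definition test_function (f : 'rV[R]_d -> R) := smooth f /\
  exists K, [/\ compact K, K `<=` G & forall x, ~ K x -> f x = 0].

Definition laplacian (f : 'rV[R]_d -> R) : 'rV[R]_d -> R :=
  fun x => \sum_(i < d) pderiv i (pderiv i f) x.

Definition real_fun (f : 'rV[R]_d -> R) : 'rV[R]_d -> R[i] := fun x => (f x)%:C.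

Definition weak_pderiv (i : 'I_d) (f g : 'rV[R]_d -> R) :=
  forall phi, test_function phi ->
    \int[row_lebesgue R d]_(x in G) (f x * pderiv i phi x) =
    - \int[row_lebesgue R d]_(x in G) (g x * phi x).

(* f belongs to the Sobolev space H^1(G), with weak gradient Df *)
Definition H1_grad (f : 'rV[R]_d -> R) (Df : 'I_d -> 'rV[R]_d -> R) :=
  L2 G (real_fun f) /\
  forall i, L2 G (real_fun (Df i)) /\ weak_pderiv i f (Df i).

(* H^1_0(G), the closure of the test functions in H^1(G) *)
Definition H10 (f : 'rV[R]_d -> R) := exists Df, H1_grad f Df /\
  exists phi : nat -> 'rV[R]_d -> R,
    [/\ forall k, test_function (phi k),
        L2cvg G (fun k => real_fun (phi k)) (real_fun f) &
        forall i, L2cvg G (fun k => real_fun (pderiv i (phi k)))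
                          (real_fun (Df i))].

(* u is in the domain of the Dirichlet Laplacian and - Delta u = lambda u; Delta u
   is taken in the sense of distributions and is in L^2(G) since u is *)
Definition dirichlet_eigenfunction (lambda : R) (u : 'rV[R]_d -> R[i]) :=
  [/\ H10 (fun x => complex.Re (u x)), H10 (fun x => complex.Im (u x)) &
      forall phi, test_function phi ->
        - cintegral (row_lebesgue R d) G (fun x => u x * (laplacian phi x)%:C) =
        lambda%:C * cintegral (row_lebesgue R d) G (fun x => u x * (phi x)%:C)].

Definition dirichlet_eigenbasis (lambda : nat -> R)
    (e : nat -> 'rV[R]_d -> R[i]) :=
  [/\ 0 < lambda 0%N,
      forall n, lambda n <= lambda n.+1,
      lambda @ \oo --> +oo,
      hilbert_basis G e &
      forall n, dirichlet_eigenfunction (lambda n) (e n)].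

End dirichlet_laplacian.

Section lipschitz_domain.
Variables (R : realType) (d : nat).

Definition lipschitz_function n (gamma : 'rV[R]_n -> R) :=
  exists L : R, forall a b, `|gamma a - gamma b| <= L * `|a - b|.

(* Near each boundary point, in suitable orthonormal coordinates (given by Q), G is
   the region above the graph of a Lipschitz function of the first d coordinates. *)
Definition bounded_lipschitz_domain (G : set 'rV[R]_d.+1) :=
  [/\ open G, connected G, G !=set0, bounded_set G &
    forall p, (closure G `\` G) p ->
      exists (Q : 'M[R]_d.+1) (gamma : 'rV[R]_d -> R) (r : R),
        [/\ Q *m Q^T = 1%:M, lipschitz_function gamma, 0 < r &
            forall x, `|x - p| < r ->
              G x <-> gamma (col' ord_max (x *m Q)) < (x *m Q) ord0 ord_max]].

End lipschitz_domain.

(* Lebesgue measurable, that is, measurable for the completed measure, whose value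
   on G0 is the outer measure of G0 *)
Definition positive_lebesgue_measurable (R : realType) (d : nat)
    (G0 : set 'rV[R]_d) :=
  completed_algebra_gen (row_lebesgue R d) G0 /\
  (0 < (row_lebesgue R d)^* G0)%mu%E.

Definition absolutely_continuous_rv dO (Omega : measurableType dO) (R : realType)
    (P : probability Omega R) (xi : {RV P >-> R}) :=
  exists rho : R -> R,
    [/\ forall x, 0 <= rho x,
        lebesgue_measure.-integrable setT (fun x => (rho x)%:E) &
        forall A : set R, measurable A ->
          P (xi @^-1` A) = (\int[lebesgue_measure]_(x in A) (rho x)%:E)%E].

(* m is the expectation (Bochner integral in L^2(G)) of Y: the simple functions
   S k = sum_(j < N k) 1_(A k j) f k j satisfy E |S k - Y| --> 0 and
   E (S k) --> m. *)
Definition L2_expectation dO (Omega : measurableType dO) (R : realType)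
    (P : probability Omega R) (d : nat) (G : set 'rV[R]_d)
    (Y : Omega -> 'rV[R]_d -> R[i]) (m : 'rV[R]_d -> R[i]) :=
  exists (N : nat -> nat) (A : nat -> nat -> set Omega)
    (f : nat -> nat -> 'rV[R]_d -> R[i]),
    let S k w x := \sum_(j < N k) (\1_(A k j) w)%:C * f k j x in
    [/\ forall k j, measurable (A k j) /\ L2 G (f k j),
        {ae P, forall w, L2cvg G (fun k => S k w) (Y w)},
        (fun k => \int[P]_w (L2norm G (fun x => S k w x - Y w x))%:E)%E
          @ \oo --> 0%E &
        L2cvg G (fun k x => \sum_(j < N k) (fine (P (A k j)))%:C * f k j x) m].

Section control_system.
Variables (R : realType) (d : nat) (alpha T : R) (G G0 : set 'rV[R]_d).
Variables (lambda : nat -> R) (e : nat -> 'rV[R]_d -> R[i]).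

Definition control_inner (u : R * 'rV[R]_d -> R[i]) (s : R) (n : nat) : R[i] :=
  L2inner G (fun x => (\1_G0 x)%:C * u (s, x)) (e n).

Definition solution_coef (xi : R) (y0 : 'rV[R]_d -> R[i])
    (u : R * 'rV[R]_d -> R[i]) (t : R) (n : nat) : R[i] :=
  L2inner G y0 (e n) *
    mittag_leffler alpha 1 (- ('i%C * (xi * lambda n * t `^ alpha)%:C)) +
  cintegral lebesgue_measure `]0, t[ (fun s =>
    control_inner u s n * ((t - s) `^ (alpha - 1))%:C *
    mittag_leffler alpha alpha
      (- ('i%C * (xi * lambda n * (t - s) `^ alpha)%:C))).

(* Y is the value y(t, .; xi; y0; u) at time t of the solution of
     d_t^alpha y - xi i Delta y = 1_G0 u in (0,T) x G,  y = 0 on (0,T) x bd(G),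
     y(0, .) = y0 in G  (Caputo derivative),
   given by its Mittag-Leffler expansion in the Dirichlet eigenbasis e; the series
   converges in L^2(G). *)
Definition solution_at (xi : R) (y0 : 'rV[R]_d -> R[i])
    (u : R * 'rV[R]_d -> R[i]) (t : R) (Y : 'rV[R]_d -> R[i]) :=
  L2 G Y /\
  L2cvg G (fun N x => \sum_(n < N) solution_coef xi y0 u t n * e n x) Y.

(* The norm of L^oo((0,T) x G0). A control is represented by a Borel function on
   the whole of R x R^d, of which only the values on (0,T) x G0 matter. *)
Definition control_norm (u : R * 'rV[R]_d -> R[i]) : \bar R :=
  ess_sup (lebesgue_measure \x row_lebesgue R d)%E
    (fun z => (Normc.normc (u z) * \1_(`]0, T[ `*` G0) z)%:E).

Definition exactly_averaged_controllable dO (Omega : measurableType dO)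
    (P : probability Omega R) (xi : {RV P >-> R}) :=
  exists C : R, 0 < C /\
    forall y0 y1, L2 G y0 -> L2 G y1 ->
      exists u : R * 'rV[R]_d -> R[i],
        [/\ cmeasurable_fun setT u,
            (control_norm u <= (C * (L2norm G y0 + L2norm G y1))%:E)%E &
            exists Y : Omega -> 'rV[R]_d -> R[i],
              (forall w, solution_at (xi w) y0 u T (Y w)) /\
              L2_expectation P G Y y1].

End control_system.

(* Main.v *)
Require Import Defs.
From HB Require Import structures.
From mathcomp Require Import all_boot all_order all_algebra.
From mathcomp.real_closed Require Import complex.
From mathcomp Require Import all_classical all_reals all_analysis.
From mathcomp Require Import measurable_realfun ess_sup_inf ring lra.
Set Implicit Arguments.
Unset Strict Implicit.
Unset Printing Implicit Defensive.
Import Order.TTheory GRing.Theory Num.Theory.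
Import numFieldNormedType.Exports.
Local Open Scope classical_set_scope.
Local Open Scope ring_scope.

(** Why no control can do it. Suppose that the system is controllable with cost C. Steer
    y0 = 0 to y1 = e_n, a unit vector, by a control u with |u| <= C. The n-th coefficient of
    the averaged final state is
      1 = E int_0^T u_n(s) (T - s)^(alpha - 1)
                    E_{alpha,alpha}(- i xi lambda_n (T - s)^alpha) ds,
    where u_n(s) = <1_G0 u(s, .), e_n> is bounded uniformly in n, because u is bounded and G
    has finite measure (control_inner_bound). For alpha < 1 the function E_{alpha,alpha} is
    bounded on the imaginary axis and decays there: |y| |E_{alpha,alpha}(- i y)| <= B
    (mittag_leffler_imag_bound). So the integral is bounded for all xi, and it is at most a
    constant times (delta lambda_n)^(-1/2) when |xi| > delta. As xi has a density, the event
    |xi| <= delta has a small probability when delta is small (small_ball_probability). First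
    delta and then n are chosen so that the right-hand side is less than 1.

    The decay of E_{alpha,alpha} on the imaginary axis is proved without contour integrals,
    by a discretization. Let p(z) = 1 - (1 - z)^alpha, a power series with nonnegative
    coefficients (the Sibuya distribution), and let g_n(zeta) be the coefficient of z^n in
    1 / ((1 - z)^alpha - zeta). On the one hand, g_n(zeta) is the power series
    sum_m zeta^m rbin (alpha (m + 1)) n (sibuya_sum_series); by Gauss's formula for Gamma
    (rbin_cvg) and a domination uniform in n (rcoef_geometric), n^(1 - alpha) g_n(x n^(-alpha))
    tends to E_{alpha,alpha}(x). On the other hand, g_n(zeta) = sum_(k <= n) b_(n,k) q^(k + 1),
    where q = 1 / (1 - zeta) and b_(n,k) >= 0 is the coefficient of z^n in p^k. On the imaginary
    axis |q| <= 1, so |g_n| is at most sum_k b_(n,k) = rbin alpha n, of order n^(alpha - 1). For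
    the decay, summation by parts bounds |zeta| |g_n| by the total variation of k |-> b_(n,k),
    and
      (n + 1) b_(n+1,k) = (n - alpha k) b_(n,k) + alpha k b_(n,k-1)
    shows that n times this variation does not increase for large n (sibuya_var_noninc): the
    variation is of order 1 / n, which gains the factor 1 / |x| in the limit.

    The states and the control are functions for which some integrands need not be measurable
    (G0 is Lebesgue measurable, the random state is arbitrary off a null set). The estimates
    rely on the monotonicity of the integral, which holds for all functions
    (normr_Rintegral_le_dominated). *)

(** * Improper integrals of powers *)

Section improper_integrals.
Variable R : realType.
Notation mu := (@lebesgue_measure R).

(** The integrand may blow up at both ends, as t `^ (b - 1) does at 0; the compact
   intervals [a + h, b - h] exhaust ]a, b[, and monotone convergence passes to the
   limit in the fundamental theorem of calculus. *)
Lemma ge0_continuous_FTC2oo (f F : R -> R) (a b la lb : R) : a < b ->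
  (forall x, a < x < b -> 0 <= f x) ->
  (forall x, a < x < b -> {for x, continuous f}) ->
  (forall x : R, a < x < b -> is_derive x 1 F (f x)) ->
  F x @[x --> a^'+] --> la -> F x @[x --> b^'-] --> lb ->
  (\int[mu]_(x in `]a, b[) (f x)%:E = (lb - la)%:E)%E.
Proof.
move=> ab f0 cf dF Fa Fb.
(* the denominator starts at 3, so that 2 h < b - a and the interval is never empty *)
pose h i : R := (b - a) / i.+3%:R.
have h0 i : 0 < h i by rewrite divr_gt0// subr_gt0.
have hlt i : h i + h i < b - a.
  rewrite -mulr2n -mulr_natl mulrCA gtr_pMr ?subr_gt0//.
  by rewrite ltr_pdivrMr// mul1r ltr_nat.
pose K i := `[a + h i, b - h i]%classic.
have KE i : forall x, K i x -> a < x < b.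
  by move=> x; rewrite /K/= in_itv/= => /andP[x1 x2]; have := h0 i; lra.
have abK : `]a, b[%classic = \bigcup_i K i.
  apply/seteqP; split => x; last by case=> i _ /KE; rewrite /= in_itv.
  rewrite /= in_itv/= => /andP[ax xb].
  have [i [h1 h2]] : exists i, h i < x - a /\ h i < b - x.
    have m0 : 0 < Num.min (x - a) (b - x) by rewrite lt_min !subr_gt0 ax.
    pose n := Num.truncn ((b - a) / Num.min (x - a) (b - x)).
    exists n.+1.
    have : h n.+1 < Num.min (x - a) (b - x).
      rewrite /h ltr_pdivrMr// mulrC -ltr_pdivrMr//.
      by apply: (lt_trans (truncnS_gt _)); rewrite -/n ltr_nat ltnS ltnW.
    by rewrite lt_min => /andP.
  by exists i => //; rewrite /K/= in_itv/=; lra.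
have ccf i : {in K i, continuous f}.
  by move=> x /set_mem /KE; exact: cf.
have IK i : (\int[mu]_(x in K i) (f x)%:E = (F (b - h i) - F (a + h i))%:E)%E.
  have cF x : a < x < b -> {for x, continuous F}.
    move=> xab; apply: differentiable_continuous; apply/derivable1_diffP.
    by have [] := dF _ xab.
  have hi := hlt i; have hi0 := h0 i.
  rewrite (@continuous_FTC2 _ f F).
  - by [].
  - lra.
  - by apply: continuous_in_subspaceT => x xK; apply: (ccf i).
  - split.
    + by move=> x; rewrite in_itv/= => xK; have [|//] := dF x; lra.
    + by apply: cvg_at_right_filter; apply: cF; lra.
    + by apply: cvg_at_left_filter; apply: cF; lra.
  - move=> x; rewrite in_itv/= => xi; rewrite derive1E.
    by have [|_ ->] := dF x; first lra.
have ndK : nondecreasing_seq K.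
  move=> m n mn; apply/subsetPset => x; rewrite /K/= !in_itv/=.
  have : h n <= h m.
    by rewrite ler_pM2l ?subr_gt0// lef_pV2 ?posrE// ler_nat.
  lra.
have cI : (\int[mu]_(x in K i) (f x)%:E)%E @[i --> \oo] -->
    (\int[mu]_(x in `]a, b[) (f x)%:E)%E.
  rewrite abK; apply: ge0_nondecreasing_set_cvg_integral => //.
  - by move=> i; exact: measurable_itv.
  - move=> i; apply/measurable_EFinP; apply: subspace_continuous_measurable_fun.
      exact: measurable_itv.
    by apply: continuous_in_subspaceT => x xK; apply: (ccf i).
  - by move=> i x /KE xab; rewrite lee_fin f0.
have h_cvg : h i @[i --> \oo] --> 0.
  have H : @harmonic R (n + 2)%N @[n --> \oo] --> (0 : R).
    by rewrite (cvg_shiftn 2); exact: cvg_harmonic.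
  have -> : h = (fun n => (b - a) * @harmonic R (n + 2)%N).
    by apply/funext => n; rewrite /h /harmonic/= addn2.
  by rewrite -[X in _ --> X](mulr0 (b - a)); apply: cvgM => //; exact: cvg_cst.
have cr : F (b - h i) - F (a + h i) @[i --> \oo] --> lb - la.
  apply: cvgB.
    move/cvg_at_leftP : Fb; apply; split.
      by move=> n; have := h0 n; lra.
    by rewrite -[X in _ --> X]subr0; apply: cvgB => //; exact: cvg_cst.
  move/cvg_at_rightP : Fa; apply; split.
    by move=> n; have := h0 n; lra.
  by rewrite -[X in _ --> X]addr0; apply: cvgD => //; exact: cvg_cst.
move: cI; under eq_fun do rewrite IK.
move/cvg_lim => <- //; apply/cvg_lim => //.
by apply: cvg_EFin; [exact: nearW|exact: cr].
Qed.

Lemma powR_continuous_at (b x : R) : 0 < x -> {for x, continuous (fun x : R => x `^ b)}.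
Proof.
move=> x0; apply: differentiable_continuous; apply/derivable1_diffP.
by apply: derivable_powR; rewrite in_itv/= x0.
Qed.

Lemma integral_powR (b T : R) : 0 < b -> 0 < T ->
  (\int[mu]_(x in `]0%R, T[) (x `^ (b - 1))%:E = (T `^ b / b)%:E)%E.
Proof.
move=> b0 T0; rewrite -[T `^ b / b]subr0 -[0 in RHS](mul0r b^-1).
apply: (@ge0_continuous_FTC2oo _ (fun x => x `^ b / b)) => //.
- by move=> x _; exact: powR_ge0.
- move=> x /andP[x0 _]; exact: powR_continuous_at.
- move=> x /andP[x0 _].
  have -> : (fun y : R => y `^ b / b) = b^-1 \*: (fun y => y `^ b).
    by apply/funext => y /=; rewrite mulrC.
  have h : is_derive x 1 (fun y : R => y `^ b) (b * x `^ (b - 1)).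
    exact: is_derive1_powR.
  apply: is_derive_eq; rewrite /GRing.scale/= mulrA mulVf ?mul1r//.
  by rewrite gt_eqF.
- by apply: cvgM; [exact: powR_cvg0|exact: cvg_cst].
- apply: cvgM; last exact: cvg_cst.
  apply: cvg_at_left_filter.
  have : {for T, continuous (fun x : R => x `^ b)} by exact: powR_continuous_at.
  exact.
Qed.

Lemma integral_powR_rev (b T : R) : 0 < b -> 0 < T ->
  (\int[mu]_(x in `]0%R, T[) ((T - x) `^ (b - 1))%:E = (T `^ b / b)%:E)%E.
Proof.
move=> b0 T0; rewrite -[T `^ b / b]subr0 -[0 in RHS](mul0r b^-1) -opprB.
rewrite -[X in X%:E]/(- (0 / b - T `^ b / b)) opprB.
pose F (x : R) := - ((T - x) `^ b / b).
rewrite (_ : T `^ b / b - 0 / b = 0 - F 0); last by rewrite /F mul0r !subr0 opprK add0r.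
apply: (@ge0_continuous_FTC2oo _ F) => //.
- by move=> x _; exact: powR_ge0.
- move=> x /andP[_ xT]; apply: (@continuous_comp _ _ _ (fun x => T - x) (fun y => y `^ (b - 1))).
    by apply: cvgB; [exact: cvg_cst|exact: cvg_id].
  by apply: powR_continuous_at; rewrite subr_gt0.
- move=> x /andP[_ xT].
  have xT' : 0 < T - x by rewrite subr_gt0.
  have h : is_derive (T - x) 1 (fun y : R => y `^ b) (b * (T - x) `^ (b - 1)).
    exact: is_derive1_powR.
  have h2 : is_derive x 1 (fun y : R => T - y) (0 - 1) by exact: is_deriveB.
  have h3 := @is_derive1_comp _ (fun y : R => y `^ b) (fun y => T - y) x _ _ h h2.
  have -> : F = - b^-1 \*: ((fun y : R => y `^ b) \o (fun y => T - y)).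
    by apply/funext => y /=; rewrite /F mulrC scaleNr.
  apply: is_derive_eq; rewrite /GRing.scale/= sub0r mulrN1 mulrNN mulrA.
  by rewrite mulVf ?mul1r// gt_eqF.
- apply: cvg_at_right_filter; apply: cvgN; apply: cvgM; last exact: cvg_cst.
  apply: (@continuous_comp _ _ _ (fun x => T - x) (fun y => y `^ b)).
    by apply: cvgB; [exact: cvg_cst|exact: cvg_id].
  by apply: powR_continuous_at; rewrite subr0.
- rewrite -oppr0 -(mul0r b^-1); apply: cvgN; apply: cvgM; last exact: cvg_cst.
  apply/cvg_at_leftP => u [uT Tu].
  move/cvg_at_rightP : (powR_cvg0 b0); apply; split.
    by move=> n; rewrite subr_gt0.
  by rewrite -(subrr T); apply: cvgB => //; exact: cvg_cst.
Qed.
End improper_integrals.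

(** * The Gamma function as a limit of binomial coefficients *)

Section gamma.
Variable R : realType.
Notation mu := (@lebesgue_measure R).

(** The coefficient of z^n in (1 - z)^(- b), that is, the generalized binomial
    coefficient of n + b - 1 over n. *)
Definition rbin (b : R) (n : nat) : R := \prod_(j < n) ((b + j%:R) / j.+1%:R).

Lemma rbin_gt0 b n : 0 < b -> 0 < rbin b n.
Proof.
move=> b0; apply: prodr_gt0 => j _; rewrite divr_gt0//.
by rewrite ltr_wpDr.
Qed.

Lemma rbin0 b : rbin b 0 = 1.
Proof. by rewrite /rbin big_ord0. Qed.

Lemma rbinS b n : rbin b n.+1 * n.+1%:R = (n%:R + b) * rbin b n.
Proof.
rewrite /rbin big_ord_recr/= -mulrA divfK ?pnatr_eq0//.
by rewrite mulrC [b + _]addrC.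
Qed.

(** Both sides are b (b + 1) ... (b + n) / n!: rbinS splits off the last factor of
    this product, and here it is the first one. *)
Lemma rbinSl b n : 0 < b -> rbin b n.+1 * n.+1%:R = b * rbin (b + 1) n.
Proof.
move=> b0; elim: n => [|n IH].
  by rewrite rbinS !rbin0 add0r !mulr1.
rewrite rbinS.
have -> : rbin b n.+1 = b * rbin (b + 1) n / n.+1%:R.
  by rewrite -IH mulfK// pnatr_eq0.
have -> : rbin (b + 1) n.+1 = (n%:R + (b + 1)) * rbin (b + 1) n / n.+1%:R.
  by rewrite -rbinS mulfK// pnatr_eq0.
have := pnatr_eq0 R n.+1; rewrite -natr1 => h.
field. by rewrite h.
Qed.

Lemma measurable_powR_onemX (T b : R) n (D : set R) : measurable D ->
  measurable_fun D (fun t : R => t `^ (b - 1) * (1 - t / T) ^+ n).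
Proof.
move=> mD; apply: measurable_funM.
  by apply: measurable_funTS; exact: measurable_powR.
apply: (@measurable_funX _ _ _ _ (fun t : R => 1 - t / T)); apply: measurable_funB => //.
by apply: measurable_funM.
Qed.

Lemma integrable_powR (T b : R) : 0 < b -> 0 < T ->
  mu.-integrable `]0%R, T[ (fun t : R => (t `^ (b - 1))%:E).
Proof.
move=> b0 T0; apply/integrableP; split.
  by apply/measurable_EFinP/measurable_funTS; exact: measurable_powR.
under eq_integral do rewrite gee0_abs ?lee_fin ?powR_ge0//.
by rewrite integral_powR// ltry.
Qed.

Lemma integrable_powR_onemX (T b : R) n : 0 < b -> 0 < T ->
  mu.-integrable `]0%R, T[ (fun t : R => (t `^ (b - 1) * (1 - t / T) ^+ n)%:E).
Proof.
move=> b0 T0; apply: (le_integrable _ _ _ (integrable_powR b0 T0)) => //.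
  by apply/measurable_EFinP; exact: measurable_powR_onemX.
move=> t /=; rewrite in_itv/= => /andP[t0 tT].
have tT1 : 0 <= 1 - t / T <= 1.
  by rewrite subr_ge0 gerBl ler_pdivrMr// mul1r divr_ge0 ?ltW.
rewrite lee_fin normrM ler_piMr// normrX exprn_ile1//.
by rewrite ger0_norm; case/andP: tT1.
Qed.

(** A beta integral without integration by parts: since
    (1 - x)^(n+1) = (1 - x)^n - x (1 - x)^n, the value at (n + 1, b) is a difference of
    the values at (n, b) and (n, b + 1), and the induction starts from the integral of a
    power. *)
Lemma Rintegral_powR_onemX (T b : R) n : 0 < b -> 0 < T ->
  \int[mu]_(t in `]0%R, T[) (t `^ (b - 1) * (1 - t / T) ^+ n) =
  T `^ b / (rbin b n.+1 * n.+1%:R).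
Proof.
move=> b0 T0; elim: n b b0 => [|n IH] b b0.
  under eq_Rintegral do rewrite expr0 mulr1.
  by rewrite /Rintegral integral_powR//= rbinS rbin0 add0r mulr1.
transitivity (\int[mu]_(t in `]0%R, T[) (t `^ (b - 1) * (1 - t / T) ^+ n
   - T^-1 * (t `^ (b + 1 - 1) * (1 - t / T) ^+ n))).
  apply: eq_Rintegral => t /set_mem /=; rewrite in_itv/= => /andP[t0 tT].
  have -> : t `^ (b + 1 - 1) = t * t `^ (b - 1).
    by rewrite mulr_powRB1 ?ltW// addrK.
  by rewrite exprS; ring.
have b1 : 0 < b + 1 by rewrite addr_gt0.
rewrite RintegralB//; last 2 first.
- exact: integrable_powR_onemX.
- have mD : measurable (`]0%R, T[%classic : set R) by exact: measurable_itv.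
  have h := @integrableZl _ _ _ mu _ mD T^-1 _ (integrable_powR_onemX n b1 T0).
  exact: h.
rewrite RintegralZl//; last exact: integrable_powR_onemX.
rewrite !IH//.
rewrite -(mulr_powRB1 (ltW T0) b1) addrK.
rewrite -!(mulrA T) mulKf ?gt_eqF//.
rewrite [rbin b n.+2 * _]rbinSl// [rbin b n.+1 * _]rbinSl//.
have h := rbinS (b + 1) n.
have h1 : rbin (b + 1) n.+1 = (n%:R + (b + 1)) * rbin (b + 1) n / n.+1%:R.
  by rewrite -rbinS mulfK// pnatr_eq0.
rewrite h h1.
have r0 : rbin (b + 1) n != 0 by rewrite gt_eqF ?rbin_gt0.
have n0 : n%:R + (b + 1) != 0 :> R by rewrite gt_eqF// ltr_wpDl.
have := pnatr_eq0 R n.+1; rewrite -natr1 => n1.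
field.
by rewrite n1 r0 n0 (gt_eqF b0).
Qed.

Lemma powR_le_expR (c : R) : exists K : R, 0 < K /\
  forall t, 1 <= t -> t `^ c <= K * expR (t / 2).
Proof.
pose k := (Num.truncn `|c|).+1.
have kc : c <= k%:R by rewrite (le_trans (ler_norm _))// ltW// truncnS_gt.
exists (k`!%:R * 2 ^+ k); split; first by rewrite mulr_gt0 ?exprn_gt0 ?ltr0n ?fact_gt0.
move=> t t1; have t0 : 0 <= t by rewrite (le_trans _ t1).
apply: (le_trans (ler_powR t1 kc)); rewrite powR_mulrn//.
have h : (t / 2) ^+ k / k`!%:R <= expR (t / 2).
  have ht : 0 <= t / 2 by rewrite divr_ge0.
  by apply: le_trans (expR_ge1Dxn k.-1 ht); rewrite /k/= lerDr.
have k0 : 0 < k`!%:R :> R by rewrite ltr0n fact_gt0.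
move: h; rewrite ler_pdivrMr// expr_div_n ler_pdivrMr ?exprn_gt0//.
by move=> /le_trans; apply; rewrite [leRHS](_ : _ = expR (t / 2) * k`!%:R * 2 ^+ k) //; ring.
Qed.

Definition gamma_integrand (b t : R) := t `^ (b - 1) * expR (- t).

Lemma measurable_gamma_integrand (b : R) (D : set R) : measurable D ->
  measurable_fun D (gamma_integrand b).
Proof.
move=> mD; apply: measurable_funM.
  by apply: measurable_funTS; exact: measurable_powR.
apply: measurable_funTS; apply: measurableT_comp => //.
Qed.

(** Near 0 the power t `^ (b - 1) dominates; on [1, +oo[ it is at most
    K exp (t / 2), which leaves the integrable exp (- t / 2). *)
Lemma integrable_gamma (b : R) : 0 < b ->
  mu.-integrable `]0%R, +oo[ (EFin \o gamma_integrand b).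
Proof.
move=> b0; have [K [K0 HK]] := powR_le_expR (b - 1).
have mD : measurable (`]0%R, +oo[%classic : set R) by exact: measurable_itv.
have m1 : measurable (`]0%R, 1[%classic : set R) by exact: measurable_itv.
pose g1 : R -> \bar R := (fun t : R => (t `^ (b - 1))%:E) \_ `]0%R, 1[.
pose g2 (t : R) : \bar R := ((2 * K)%:E * (exponential_pdf 2^-1 t)%:E)%E.
have i1 : mu.-integrable `]0%R, +oo[ g1.
  apply/integrable_mkcond => //.
  rewrite -patch_setI setIidr; last by move=> t /=; rewrite !in_itv/= => /andP[->].
  by apply: (iffLR (integrable_mkcond _ _)) => //; exact: integrable_powR.
have i2 : mu.-integrable `]0%R, +oo[ g2.
  apply: integrableZl => //.
  apply: (integrableS measurableT) => //.
  by apply: integrable_exponential_pdf; rewrite invr_gt0.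
have i3 : mu.-integrable `]0%R, +oo[ (g1 \+ g2)%E by exact: integrableD.
apply: (le_integrable _ _ _ i3) => //.
  by apply/measurable_EFinP; exact: measurable_gamma_integrand.
move=> t /=; rewrite in_itv/= andbT => t0.
have g0 : 0 <= gamma_integrand b t by rewrite mulr_ge0 ?powR_ge0 ?expR_ge0.
have e0 : 0 <= 2 * K * (2^-1 * expR (- 2^-1 * t)).
  by rewrite !mulr_ge0 ?expR_ge0// ?invr_ge0// ltW.
apply: (@le_trans _ _ ((g1 \+ g2)%E t)); last exact: lee_abs.
rewrite ger0_norm// /g2 (exponential_pdfE _ (ltW t0)) /g1 /patch.
case: ifPn => [_|].
  rewrite -EFinM -EFinD lee_fin.
  apply: ler_wpDr => //; rewrite ler_piMr ?powR_ge0//.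
  by rewrite -expR0 ler_expR oppr_le0 ltW.
rewrite notin_setE/= in_itv/= t0/= => /negP; rewrite -leNgt => t1.
rewrite (_ : point = 0%E)// add0e -EFinM lee_fin.
rewrite /gamma_integrand.
apply: (le_trans (ler_wpM2r (expR_ge0 _) (HK _ t1))).
rewrite -mulrA -expRD (_ : t / 2 - t = - 2^-1 * t); last by field.
by rewrite [leRHS](_ : _ = K * expR (- 2^-1 * t)) //; field.
Qed.

Lemma GammaE (b : R) : 0 < b ->
  (\int[mu]_(t in `]0%R, +oo[) (gamma_integrand b t)%:E = (Gamma b)%:E)%E.
Proof.
move=> b0; rewrite /Gamma /Rintegral fineK//.
by apply: integrable_fin_num => //; exact: integrable_gamma.
Qed.

(** The integrand is positive, so a zero integral would make ]0, 1[ negligible. *)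
Lemma Gamma_gt0 (b : R) : 0 < b -> 0 < Gamma b.
Proof.
move=> b0.
pose m := gamma_integrand b.
have mpos t : 0 < t -> 0 < m t by move=> t0; rewrite mulr_gt0 ?powR_gt0 ?expR_gt0.
rewrite lt_neqAle; apply/andP; split; last first.
  by apply: Rintegral_ge0 => t _; rewrite mulr_ge0 ?powR_ge0 ?expR_ge0.
apply/negP => /eqP G0.
have mD : measurable (`]0%R, +oo[%classic : set R) by exact: measurable_itv.
have h : (\int[mu]_(t in `]0%R, +oo[) `|(m t)%:E| = 0)%E.
  under eq_integral => t _ do rewrite gee0_abs ?lee_fin ?mulr_ge0 ?powR_ge0 ?expR_ge0//.
  by rewrite GammaE// -G0.
have [N [mN N0 sub]] : ae_eq mu `]0%R, +oo[%classic (EFin \o m) (cst 0%E).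
  apply/ae_eq_integral_abs => //.
  by apply/measurable_EFinP; exact: measurable_gamma_integrand.
have : (mu (`]0%R, 1%R[%classic : set R) <= mu N)%E.
  apply: le_measure; rewrite ?inE//.
  move=> t /=; rewrite in_itv/= => /andP[t0 _]; apply: sub => /= H.
  have := mpos _ t0; have : `]0%R, +oo[%classic t by rewrite /= in_itv/= t0.
  by move/H => [->]; rewrite ltxx.
by rewrite N0 lebesgue_measure_itv/= lte01 oppr0 adde0 lee_fin ler10.
Qed.

(** The factor exp 1 makes up for the exponent n instead of n + 1, so that one
    integrable function dominates all the integrands of Gauss's formula, n = 0 included. *)
Lemma onemX_le_expR (t : R) (n : nat) : 0 < t < n.+1%:R ->
  (1 - t / n.+1%:R) ^+ n <= expR 1 * expR (- t).
Proof.
move=> /andP[t0 tn].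
have n0 : 0 < n.+1%:R :> R by rewrite ltr0n.
have tn1 : t / n.+1%:R <= 1 by rewrite ler_pdivrMr// mul1r ltW.
apply: (@le_trans _ _ (expR (- (t / n.+1%:R)) ^+ n)).
  apply: lerXn2r; rewrite ?nnegrE ?subr_ge0 ?expR_ge0//.
  by have := expR_ge1Dx (- (t / n.+1%:R)).
rewrite -expRM_natl -expRD ler_expR -subr_ge0.
rewrite [leRHS](_ : _ = 1 - t / n.+1%:R) ?subr_ge0//.
have := pnatr_eq0 R n.+1; rewrite -natr1 => h.
by field; rewrite h.
Qed.

Lemma onemX_cvg_expR (t : R) : 0 < t ->
  (1 - t / n.+1%:R) ^+ n @[n --> \oo] --> expR (- t).
Proof.
move=> t0.
pose u n : R := - (t * (n%:R / n.+1%:R)).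
have cn : n%:R / n.+1%:R @[n --> \oo] --> (1 : R).
  have -> : (fun n : nat => n%:R / n.+1%:R : R) = (fun n => 1 - @harmonic R n).
    apply/funext => n; have := pnatr_eq0 R n.+1; rewrite /harmonic/= -natr1 => h.
    by field; rewrite h.
  rewrite -[X in _ --> X]subr0; apply: cvgB; first exact: cvg_cst.
  exact: cvg_harmonic.
have cu : expR (u n) @[n --> \oo] --> expR (- t).
  apply: continuous_cvg; first exact: continuous_expR.
  rewrite -[X in _ --> - X]mulr1; apply: cvgN; apply: cvgM => //; exact: cvg_cst.
(* squeeze by exp (- x / (1 - x)) <= 1 - x <= exp (- x) at x = t / (n + 1) *)
pose v n : R := - (t * (n%:R / n.+1%:R) / (1 - t / n.+1%:R)).
have cv : expR (v n) @[n --> \oo] --> expR (- t).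
  apply: continuous_cvg; first exact: continuous_expR.
  rewrite (_ : - t = - (t * 1 / 1)); last by rewrite mulr1 divr1.
  apply: cvgN; apply: cvgM.
    by apply: cvgM => //; exact: cvg_cst.
  apply: cvgV; first exact: oner_neq0.
  rewrite -[X in _ --> X]subr0; apply: cvgB; first exact: cvg_cst.
  rewrite -(mulr0 t); apply: cvgM; first exact: cvg_cst.
  exact: cvg_harmonic.
apply: (squeeze_cvgr _ cv cu).
near=> n.
have n0 : 0 < n.+1%:R :> R by rewrite ltr0n.
have tn : t < n.+1%:R.
  rewrite (lt_le_trans (truncnS_gt _))// ler_nat ltnS.
  by near: n; exists (Num.truncn t).
have x1 : 0 < 1 - t / n.+1%:R by rewrite subr_gt0 ltr_pdivrMr// mul1r.
rewrite /u /v; move: n0 tn x1; set N := n.+1%:R => n0 tn x1; clearbody N.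
have N0 : N != 0 by rewrite gt_eqF.
have Nt : N - t != 0 by rewrite gt_eqF ?subr_gt0.
apply/andP; split.
  rewrite [leLHS](_ : _ = expR (- ((t / N) / (1 - t / N))) ^+ n).
    apply: lerXn2r; rewrite ?nnegrE ?expR_ge0 ?(ltW x1)//.
    rewrite expRN invf_ple ?posrE ?expR_gt0//.
    apply: le_trans (expR_ge1Dx _).
    by rewrite [leLHS](_ : _ = 1 + t / N / (1 - t / N))//; field; rewrite N0 Nt.
  by rewrite -expRM_natl; congr expR; field; rewrite N0 Nt.
rewrite [leRHS](_ : _ = expR (- (t / N)) ^+ n).
  apply: lerXn2r; rewrite ?nnegrE ?expR_ge0 ?(ltW x1)//.
  by have := expR_ge1Dx (- (t / N)).
by rewrite -expRM_natl; congr expR; field; rewrite N0.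
Unshelve. all: by end_near. Qed.

(** Gauss's formula for Gamma: the left-hand side is the inverse of the integral of
    t `^ (b - 1) (1 - t / (n + 1))^n over ]0, n + 1[, and dominated convergence applies. *)
Lemma rbin_cvg (b : R) : 0 < b ->
  n.+1%:R * rbin b n.+1 / n.+1%:R `^ b @[n --> \oo] --> (Gamma b)^-1.
Proof.
move=> b0.
pose h (n : nat) (t : R) := t `^ (b - 1) * (1 - t / n.+1%:R) ^+ n.
pose f (n : nat) : R -> \bar R := (EFin \o h n) \_ `]0%R, (n.+1%:R : R)[.
have mh n : measurable_fun (setT : set R) (h n) by exact: measurable_powR_onemX.
have nS0 n : 0 < n.+1%:R :> R by rewrite ltr0n.
have mf n : measurable_fun (`]0%R, +oo[%classic : set R) (f n).
  apply: measurable_funTS; apply: (iffLR (measurable_restrictT _ _)) => //.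
  by apply: measurable_funTS; apply/measurable_EFinP; exact: mh.
have If n : (\int[mu]_(t in `]0%R, +oo[) f n t)%E =
    (n.+1%:R `^ b / (rbin b n.+1 * n.+1%:R))%:E.
  rewrite -integral_mkcondr setIidr; last first.
    by move=> t /=; rewrite !in_itv/= => /andP[->].
  rewrite -Rintegral_powR_onemX// /Rintegral fineK//.
  by apply: integrable_fin_num => //; exact: integrable_powR_onemX.
have [|||||_ _] := @dominated_convergence _ _ _ mu (`]0%R, +oo[%classic : set R) _
    f (EFin \o gamma_integrand b) (fun t => (expR 1)%:E * (gamma_integrand b t)%:E)%E mf.
- exact: measurable_itv.
- by apply/measurable_EFinP; exact: measurable_gamma_integrand.
- apply: aeW => t /=; rewrite in_itv/= andbT => t0.
  apply: (@cvg_trans _ (EFin \o (fun n => h n t) @ \oo)).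
    apply: near_eq_cvg; near=> n.
    rewrite /f /patch mem_set//= in_itv/= t0/=.
    rewrite (lt_le_trans (truncnS_gt _))// ler_nat ltnS.
    by near: n; exists (Num.truncn t).
  apply: cvg_EFin; first exact: nearW.
  by apply: cvgM; [exact: cvg_cst|exact: onemX_cvg_expR].
- by apply: integrableZl => //; exact: integrable_gamma.
- apply: aeW => t n /=; rewrite in_itv/= andbT => t0.
  have g0 : 0 <= gamma_integrand b t by rewrite mulr_ge0 ?powR_ge0 ?expR_ge0.
  rewrite /f /patch; case: ifPn => [|_]; last first.
    by rewrite abse0 mule_ge0// lee_fin ?expR_ge0.
  rewrite inE/= in_itv/= => /andP[_ tn].
  have n1 : 0 <= 1 - t / n.+1%:R by rewrite subr_ge0 ler_pdivrMr// mul1r ltW.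
  rewrite -EFinM lee_fin ger0_norm; last by rewrite mulr_ge0 ?powR_ge0 ?exprn_ge0.
  rewrite /gamma_integrand mulrCA ler_wpM2l ?powR_ge0//.
  by apply: onemX_le_expR; rewrite t0.
under eq_fun do rewrite If.
rewrite GammaE// => /fine_cvg/= H.
have G0 : Gamma b != 0 by rewrite gt_eqF// Gamma_gt0.
rewrite (_ : (fun n => _) = (fun n => (n.+1%:R `^ b / (rbin b n.+1 * n.+1%:R))^-1)).
  exact: cvgV G0 H.
by apply/funext => n; rewrite invf_div [rbin _ _ * _]mulrC.
Unshelve. all: by end_near. Qed.

(** A bound uniform in n, for the passage to the limit under a sum over b. Write
    n rbin b n = b prod_(0 < j < n) (1 + b / j): the factors with j <= J are at most 1 + b,
    and the others are at most (j / (j - 1)) `^ b, whose product telescopes. *)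
Lemma rbin_le (b : R) (J n : nat) : 0 < b -> (0 < J < n)%N ->
  n%:R * rbin b n / n%:R `^ b <= b * (1 + b) ^+ J / J%:R `^ b.
Proof.
move=> b0 /andP[J0].
have wS k : (0 < k)%N -> k.+1%:R * rbin b k.+1 = k%:R * rbin b k * (1 + b / k%:R).
  move=> k0; have k0' : k%:R != 0 :> R by rewrite pnatr_eq0 -lt0n.
  by rewrite mulrC rbinS; field; rewrite k0'.
have base : J.+1%:R * rbin b J.+1 <= b * (1 + b) ^+ J.
  elim: J {J0} => [|J IH].
    by rewrite expr0 mulrC rbinS rbin0 add0r !mulr1.
  rewrite wS// exprSr mulrA; apply: ler_pM.
  - by rewrite mulr_ge0// ltW// rbin_gt0.
  - by rewrite addr_ge0// divr_ge0 ?ltW.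
  - exact: IH.
  - by rewrite lerD2l ler_pdivrMr ?ltr0n// ler_peMr ?(ltW b0)// ler1n.
have J0' : 0 < J%:R :> R by rewrite ltr0n.
have main m : (J <= m)%N ->
    m.+1%:R * rbin b m.+1 <= b * (1 + b) ^+ J * (m%:R / J%:R) `^ b.
  elim: m => [|m IH]; first by rewrite leqn0 => /eqP J00; rewrite J00 in J0.
  rewrite leq_eqVlt => /predU1P[<-|].
    by rewrite divff ?gt_eqF// powR1 mulr1.
  rewrite ltnS => Jm; have m0 : 0 < m%:R :> R by rewrite ltr0n (leq_trans J0).
  have mS0 : 0 < m.+1%:R :> R by rewrite ltr0n.
  rewrite wS//.
  (* 1 / (m + 1) <= ln ((m + 1) / m) *)
  have step : 1 + b / m.+1%:R <= (m.+1%:R / m%:R) `^ b.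
    apply: (le_trans (expR_ge1Dx _)).
    rewrite /powR gt_eqF ?divr_gt0// ler_expR ler_wpM2l ?(ltW b0)//.
    rewrite -ler_expR lnK ?posrE ?divr_gt0//.
    rewrite -[leRHS]invrK -[_^-1]opprK expRN lef_pV2 ?posrE ?expR_gt0 ?invr_gt0 ?divr_gt0//.
    apply: le_trans (expR_ge1Dx _); rewrite invf_div.
    rewrite [leLHS](_ : _ = 1 - m.+1%:R^-1)//.
    by move: mS0; rewrite -natr1 => mS0; field; rewrite gt_eqF.
  rewrite (_ : m.+1%:R / J%:R = m%:R / J%:R * (m.+1%:R / m%:R)); last first.
    by field; rewrite !gt_eqF.
  rewrite powRM ?divr_ge0// mulrA; apply: ler_pM => //.
  - by rewrite mulr_ge0// ltW// rbin_gt0.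
  - by rewrite addr_ge0// divr_ge0 ?ltW.
  - exact: IH.
case: n => // n; rewrite ltnS => Jn.
have n0 : 0 < n.+1%:R :> R by rewrite ltr0n.
have c0 : 0 <= b * (1 + b) ^+ J by rewrite mulr_ge0 ?exprn_ge0 ?addr_ge0// ltW.
rewrite ler_pdivrMr ?powR_gt0//; apply: (le_trans (main _ Jn)).
rewrite -[leRHS]mulrA; rewrite ler_wpM2l// [leRHS]mulrC ler_pdivlMr ?powR_gt0// -powRM ?divr_ge0//.
rewrite divfK ?gt_eqF//; apply: ge0_ler_powR; rewrite ?nnegrE ?(ltW b0)//.
by rewrite ler_nat.
Qed.

(** n^(1 - b) rbin b n with b = alpha (m + 1), which tends to 1 / Gamma b: the m-th
    coefficient of the discrete approximation of E_{alpha,alpha}. *)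
Definition rcoef (alpha : R) (n m : nat) : R :=
  n%:R * rbin (alpha * m%:R + alpha) n / n%:R `^ (alpha * m%:R + alpha).

Lemma rcoef_ge0 (alpha : R) n m : 0 < alpha -> 0 <= rcoef alpha n m.
Proof.
move=> a0; have b0 : 0 < alpha * m%:R + alpha by rewrite ltr_wpDl// mulr_ge0// ltW.
by rewrite /rcoef divr_ge0 ?powR_ge0// mulr_ge0// ltW// rbin_gt0.
Qed.

(** This domination justifies the limit under the sum over m. In rbin_le, taking
    J `^ alpha >= 4 x makes x^m / J `^ b at most 4^(-m); the remaining factor
    b (1 + b)^J is polynomial in m, hence at most a constant times 2^m. *)
Lemma rcoef_geometric (alpha x : R) : 0 < alpha <= 1 -> 0 <= x ->
  exists (J : nat) (K : R), 0 < K /\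
    forall n m, (J < n)%N -> rcoef alpha n m * x ^+ m <= K * 2^-1 ^+ m.
Proof.
move=> /andP[a0 a1] x0.
pose J := (Num.truncn ((4 * x) `^ alpha^-1)).+1.
have [K [K0 HK]] := powR_le_expR J.+1%:R.
exists J, (K * expR 1); split; first by rewrite mulr_gt0 ?expR_gt0.
move=> n m Jn; set b := alpha * m%:R + alpha.
have b0 : 0 < b by rewrite /b ltr_wpDl// mulr_ge0// ltW.
have bm : b <= m.+1%:R.
  by rewrite -natr1 /b lerD// ler_piMl.
have J0 : 0 < J%:R :> R by rewrite ltr0n.
have J1 : 1 <= J%:R `^ alpha :> R.
  by rewrite -[leLHS](powRr0 (J%:R : R)) ler_powR ?(ltW a0)// ler1n.
have J4 : 4 * x <= J%:R `^ alpha.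
  have x40 : 0 <= 4 * x by rewrite mulr_ge0.
  have -> : 4 * x = ((4 * x) `^ alpha^-1) `^ alpha.
    by rewrite -powRrM mulVf ?gt_eqF// powRr1.
  apply: ge0_ler_powR; rewrite ?nnegrE ?(ltW a0)// ?powR_ge0//.
  by rewrite ltW// truncnS_gt.
have Jb : J%:R `^ b = (J%:R `^ alpha) ^+ m * J%:R `^ alpha.
  by rewrite /b powRD ?lt0r_neq0 ?implybT// powRrM powR_mulrn ?powR_ge0.
rewrite /rcoef -/b; have b0' := ltW b0; have b1 : 0 <= 1 + b by rewrite addr_ge0.
clearbody b.
apply: (@le_trans _ _ (b * (1 + b) ^+ J / J%:R `^ b * x ^+ m)).
  by rewrite ler_wpM2r ?exprn_ge0// rbin_le.
have h1 : b * (1 + b) ^+ J <= K * expR 1 * 2 ^+ m.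
  apply: (@le_trans _ _ (m.+2%:R ^+ J.+1)).
    rewrite exprS; apply: ler_pM; rewrite ?exprn_ge0//.
      by rewrite (le_trans bm)// ler_nat.
    by apply: lerXn2r; rewrite ?nnegrE// -[m.+2%:R]nat1r lerD2l.
  rewrite -[leLHS]powR_mulrn//; apply: (le_trans (HK _ _)); first by rewrite ler1n.
  rewrite -mulrA ler_wpM2l ?(ltW K0)//.
  rewrite (_ : m.+2%:R / 2 = 1 + m%:R * 2^-1); last first.
    by rewrite -[m.+2]addn2 natrD; field.
  rewrite expRD ler_wpM2l ?expR_ge0// expRM_natl; apply: lerXn2r; rewrite ?nnegrE ?expR_ge0//.
  rewrite -[2^-1]opprK expRN invf_ple ?posrE ?expR_gt0//.
  by apply: le_trans (expR_ge1Dx _); lra.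
have h2 : x ^+ m / J%:R `^ b <= 4^-1 ^+ m.
  rewrite Jb ler_pdivrMr; last by rewrite mulr_gt0 ?exprn_gt0 ?powR_gt0.
  rewrite mulrA -exprMn; apply: (@le_trans _ _ ((4^-1 * J%:R `^ alpha) ^+ m)).
    have x4 : x <= 4^-1 * J%:R `^ alpha by rewrite mulrC ler_pdivlMr// mulrC.
    apply: lerXn2r => //; rewrite nnegrE.
    by rewrite mulr_ge0 ?powR_ge0.
  by rewrite ler_peMr// exprn_ge0// mulr_ge0 ?powR_ge0.
rewrite -mulrA [_^-1 * _]mulrC.
apply: (@le_trans _ _ (K * expR 1 * 2 ^+ m * 4^-1 ^+ m)).
  apply: ler_pM => //; rewrite ?mulr_ge0 ?invr_ge0 ?powR_ge0 ?exprn_ge0//.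
rewrite -mulrA -exprMn (_ : 2 * 4^-1 = 2^-1)//; by field.
Qed.

Lemma rcoef_cvg (alpha : R) m : 0 < alpha ->
  rcoef alpha n.+1 m @[n --> \oo] --> (Gamma (alpha * m%:R + alpha))^-1.
Proof.
by move=> a0; apply: rbin_cvg; rewrite ltr_wpDl// mulr_ge0// ltW.
Qed.
End gamma.

(** * The Sibuya array *)

Section sibuya.
Variables (R : realType) (alpha : R).
Hypothesis alpha01 : 0 < alpha < 1.

Let alpha_gt0 : 0 < alpha. Proof. by case/andP: alpha01. Qed.

(** sibuya n k is the coefficient of z^n in p(z)^k, where p(z) = 1 - (1 - z)^alpha is
    the generating function of the Sibuya distribution: the probability that k independent
    Sibuya variables add up to n. The recurrence is (1 - z) (p^k)' = alpha k (p^(k-1) - p^k);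
    as its coefficients are nonnegative for k <= n, it also gives the sign. *)
Fixpoint sibuya (n k : nat) : R :=
  if n is n'.+1 then
    ((n'%:R - alpha * k%:R) * sibuya n' k + alpha * k%:R * sibuya n' k.-1)
      / n'.+1%:R
  else (k == 0%N)%:R.

Lemma sibuyaS n k : n.+1%:R * sibuya n.+1 k =
  (n%:R - alpha * k%:R) * sibuya n k + alpha * k%:R * sibuya n k.-1.
Proof. by rewrite /= mulrC divfK// pnatr_eq0. Qed.

Lemma sibuya_gt n k : (n < k)%N -> sibuya n k = 0.
Proof.
elim: n k => [|n IH] [|k]//= nk.
by rewrite !IH ?mulr0 ?addr0 ?mul0r// ltnW.
Qed.

Lemma sibuya_coef_ge0 (n k : nat) : (k <= n)%N -> 0 <= n%:R - alpha * k%:R.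
Proof.
move=> kn; rewrite subr_ge0; apply: (@le_trans _ _ k%:R); last by rewrite ler_nat.
by rewrite ler_piMl// ltW//; case/andP: alpha01.
Qed.

Lemma sibuya_ge0 n k : 0 <= sibuya n k.
Proof.
elim: n k => [|n IH] k; first by rewrite /= ler0n.
have [kn|nk] := leqP k n; last first.
  rewrite /= (sibuya_gt nk) mulr0 add0r divr_ge0// mulr_ge0//.
  by rewrite mulr_ge0// ltW.
rewrite /= divr_ge0// addr_ge0// mulr_ge0 ?sibuya_coef_ge0//.
by rewrite mulr_ge0// ltW.
Qed.

(** The coefficient of z^n in (1 - z)^(- alpha (m + 1)) = (1 - p(z))^(- (m + 1)). The two
    sides satisfy the same recurrence in n, because
    (k + 1) C(m + k + 1, k + 1) = (m + k + 1) C(m + k, k). *)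
Lemma rbin_sibuya n m : rbin (alpha * m%:R + alpha) n =
  \sum_(k < n.+1) sibuya n k * 'C(m + k, k)%:R.
Proof.
elim: n => [|n IH]; first by rewrite big_ord1 rbin0 addn0 bin0 mulr1.
have n0 : n.+1%:R != 0 :> R by rewrite pnatr_eq0.
apply: (mulIf n0); rewrite rbinS IH mulr_sumr mulr_suml.
under [RHS]eq_bigr do rewrite mulrC mulrA sibuyaS mulrDl.
rewrite big_split/= [X in _ = X + _]big_ord_recr/= (sibuya_gt (ltnSn n)).
rewrite mulr0 mul0r addr0 [X in _ = _ + X]big_ord_recl/= mulr0 !mul0r add0r.
rewrite -big_split/=; apply: eq_bigr => k _.
have h : k.+1%:R * 'C(m + k.+1, k.+1)%:R = (m%:R + k%:R + 1) * 'C(m + k, k)%:R :> R.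
  by rewrite -natrD natr1 -!natrM addnS mul_bin_diag.
rewrite /bump/= add1n add0n.
have -> : alpha * k.+1%:R * sibuya n k * 'C(m + k.+1, k.+1)%:R =
    alpha * sibuya n k * (k.+1%:R * 'C(m + k.+1, k.+1)%:R) by ring.
by rewrite h; ring.
Qed.

Definition dsibuya n k : R := sibuya n k - (if k is k'.+1 then sibuya n k' else 0).

Definition sibuya_var n : R := \sum_(k < n.+2) `|dsibuya n k|.

(** Each difference dsibuya n k enters two differences at n + 1, with total weight
    (n - alpha k) + alpha k = n; this is why their total variation decays like 1 / n. *)
Lemma dsibuyaS n k : n.+1%:R * dsibuya n.+1 k.+1 =
  (n%:R - alpha * k.+1%:R) * dsibuya n k.+1 + alpha * k%:R * dsibuya n k.
Proof.
rewrite /dsibuya mulrBr !sibuyaS/=; case: k => [|k] /=.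
  by rewrite !mulr0 !mul0r; ring.
by rewrite -!natr1; ring.
Qed.

Lemma dsibuya0 n : n.+1%:R * dsibuya n.+1 0 = n%:R * dsibuya n 0.
Proof. by rewrite /dsibuya !subr0 sibuyaS !mulr0 subr0 mul0r addr0. Qed.

(** The assumption on n makes the coefficient n - alpha k nonnegative up to k = n + 1, the
    last index where a difference can be nonzero. *)
Lemma sibuya_var_noninc n : alpha * n.+1%:R <= n%:R ->
  n.+1%:R * sibuya_var n.+1 <= n%:R * sibuya_var n.
Proof.
move=> an; rewrite /sibuya_var !mulr_sumr.
rewrite big_ord_recl/= -{1}[n.+1%:R]ger0_norm// -normrM dsibuya0 normrM ger0_norm//.
have -> : \sum_(k < n.+2) n%:R * `|dsibuya n k| =
    \sum_(k < n.+2) (n%:R - alpha * k%:R) * `|dsibuya n k| +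
    \sum_(k < n.+2) alpha * k%:R * `|dsibuya n k|.
  by rewrite -big_split/=; apply: eq_bigr => k _; ring.
have -> : \sum_(k < n.+2) (n%:R - alpha * k%:R) * `|dsibuya n k| =
   n%:R * `|dsibuya n 0| +
   \sum_(k < n.+2) (n%:R - alpha * k.+1%:R) * `|dsibuya n k.+1|.
  rewrite big_ord_recl/= mulr0 subr0; congr (_ + _).
  rewrite [RHS]big_ord_recr/= /dsibuya (@sibuya_gt n n.+2)// (@sibuya_gt n n.+1)//.
  by rewrite subr0 normr0 mulr0 addr0.
rewrite -addrA lerD2l -big_split/=; apply: ler_sum => k _.
rewrite -{1}[n.+1%:R]ger0_norm// -normrM /bump/= add1n dsibuyaS.
apply: (le_trans (ler_normD _ _)); apply: lerD; rewrite normrM.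
  have [kn|kn] := leqP k n.
    rewrite ger0_norm// subr_ge0 (le_trans _ an)// ler_wpM2l ?(ltW alpha_gt0)//.
    by rewrite ler_nat.
  have -> : k = n.+1 :> nat by apply/eqP; rewrite eqn_leq kn -ltnS ltn_ord.
  by rewrite /dsibuya (@sibuya_gt n n.+2)// (@sibuya_gt n n.+1)// subr0 normr0 !mulr0.
by rewrite ger0_norm// mulr_ge0// ltW.
Qed.

Lemma sibuya_var_bounded : exists (N : nat) (C : R),
  forall n, (N <= n)%N -> n%:R * sibuya_var n <= C.
Proof.
have a1 : 0 < 1 - alpha by rewrite subr_gt0; case/andP: alpha01.
pose N := (Num.truncn (alpha / (1 - alpha))).+1.
exists N, (N%:R * sibuya_var N); elim=> [|n IH]; first by rewrite leqn0.
rewrite leq_eqVlt => /predU1P[->//|]; rewrite ltnS => Nn.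
apply: le_trans (IH Nn); apply: sibuya_var_noninc.
have : alpha / (1 - alpha) <= n%:R.
  by rewrite (le_trans (ltW (truncnS_gt _)))// ler_nat.
by rewrite ler_pdivrMr// -natr1; lra.
Qed.
End sibuya.

(** * Complex numbers *)

Section normc.
Variable R : realType.
Implicit Types x y z : R[i].
Local Open Scope complex_scope.
Notation normc := (@Normc.normc R).

Lemma normc_ge0 x : 0 <= normc x.
Proof. by case: x => a b; rewrite sqrtr_ge0. Qed.

Lemma normcX x n : normc (x ^+ n) = normc x ^+ n.
Proof.
elim: n => [|n IH]; first by rewrite !expr0; exact: Normc.normc1.
by rewrite !exprS Normc.normcM IH.
Qed.

Lemma normc_real (a : R) : normc a%:C = `|a|.
Proof. by rewrite /= expr0n/= addr0 sqrtr_sqr. Qed.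

Lemma normc_sum (I : Type) (s : seq I) (P : pred I) (F : I -> R[i]) :
  normc (\sum_(i <- s | P i) F i) <= \sum_(i <- s | P i) normc (F i).
Proof.
elim/big_rec2 : _ => [|i y z _ h]; first by rewrite Normc.normc0.
by apply: (le_trans (le_normcD _ _)); rewrite lerD2l.
Qed.

Lemma normc_ge_absRe x : `|complex.Re x| <= normc x.
Proof.
case: x => a b /=; rewrite -sqrtr_sqr ler_sqrt ?addr_ge0 ?sqr_ge0//.
by rewrite lerDl sqr_ge0.
Qed.

Lemma normc_ge_absIm x : `|complex.Im x| <= normc x.
Proof.
case: x => a b /=; rewrite -sqrtr_sqr ler_sqrt ?addr_ge0 ?sqr_ge0//.
by rewrite lerDr sqr_ge0.
Qed.

Lemma normc_le_ReIm x : normc x <= `|complex.Re x| + `|complex.Im x|.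
Proof.
case: x => a b /=; rewrite -[leRHS]ger0_norm ?addr_ge0// -sqrtr_sqr.
rewrite ler_sqrt ?sqr_ge0// sqrrD !real_normK ?num_real// -addrA lerD2l lerDr.
by rewrite mulrn_wge0// mulr_ge0.
Qed.

Lemma normc_conj x : normc (conjc x) = normc x.
Proof. by case: x => a b /=; rewrite sqrrN. Qed.

Lemma Re_mulconj x : complex.Re (x * conjc x) = normc x ^+ 2.
Proof.
case: x => a b /=; rewrite mulrN opprK sqr_sqrtr ?addr_ge0 ?sqr_ge0//.
Qed.

Lemma normc_opp x : normc (- x) = normc x.
Proof. by case: x => a b /=; rewrite !sqrrN. Qed.

Lemma normc_sqr x : normc x ^+ 2 = complex.Re x ^+ 2 + complex.Im x ^+ 2.
Proof. by case: x => a b; rewrite /= sqr_sqrtr ?addr_ge0 ?sqr_ge0. Qed.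

Lemma Re_conj x : complex.Re (conjc x) = complex.Re x. Proof. by case: x. Qed.

Lemma Im_conj x : complex.Im (conjc x) = - complex.Im x. Proof. by case: x. Qed.

Lemma ReD x y : complex.Re (x + y) = complex.Re x + complex.Re y.
Proof. by case: x => ? ?; case: y. Qed.

Lemma ImD x y : complex.Im (x + y) = complex.Im x + complex.Im y.
Proof. by case: x => ? ?; case: y. Qed.

Lemma ReB x y : complex.Re (x - y) = complex.Re x - complex.Re y.
Proof. by case: x => ? ?; case: y. Qed.

Lemma Re_mul x y : complex.Re (x * y) =
  complex.Re x * complex.Re y - complex.Im x * complex.Im y.
Proof. by case: x => ? ?; case: y. Qed.

Lemma Im_mul x y : complex.Im (x * y) =
  complex.Re x * complex.Im y + complex.Im x * complex.Re y.
Proof. by case: x => ? ?; case: y. Qed.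

Lemma Re_sum (I : Type) (s : seq I) (P : pred I) (F : I -> R[i]) :
  complex.Re (\sum_(i <- s | P i) F i) = \sum_(i <- s | P i) complex.Re (F i).
Proof. by elim/big_rec2 : _ => // i y z _ <-; rewrite ReD. Qed.

Lemma Im_sum (I : Type) (s : seq I) (P : pred I) (F : I -> R[i]) :
  complex.Im (\sum_(i <- s | P i) F i) = \sum_(i <- s | P i) complex.Im (F i).
Proof. by elim/big_rec2 : _ => // i y z _ <-; rewrite ImD. Qed.

Lemma normc_imag (y : R) : normc (- ('i * y%:C)) = `|y|.
Proof.
by rewrite normc_opp Normc.normcM normc_real /= expr0n/= expr1n add0r sqrtr1 mul1r.
Qed.

(** The reason why the imaginary axis is good: the resolvent 1 / (1 - zeta) is there a
    contraction. *)
Lemma normc_1Dimag (y : R) : 1 <= normc (1 - - ('i * y%:C)).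
Proof.
rewrite opprK /= -[leLHS]sqrtr1 ler_sqrt ?addr_ge0 ?sqr_ge0//.
by rewrite !mul0r !mul1r subr0 addr0 expr1n lerDl sqr_ge0.
Qed.
End normc.

(** * The Mittag-Leffler function on the imaginary axis *)

Section negative_binomial_series.
Variable R : realType.
Local Open Scope complex_scope.
Notation normc := (@Normc.normc R).

Definition nbin_sum (k M : nat) (x : R[i]) : R[i] :=
  \sum_(m < M) 'C(m + k, k)%:R * x ^+ m.

Lemma nbin_sum0 M x : (1 - x) * nbin_sum 0 M x = 1 - x ^+ M.
Proof.
elim: M => [|M IH]; first by rewrite /nbin_sum big_ord0 mulr0 expr0 subrr.
rewrite /nbin_sum big_ord_recr/= -/(nbin_sum 0 M x) mulrDr IH bin0 mul1r exprS.
ring.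
Qed.

Lemma nbin_sumS k M x :
  (1 - x) * nbin_sum k.+1 M x = nbin_sum k M x - 'C(M + k, k.+1)%:R * x ^+ M.
Proof.
elim: M => [|M IH].
  by rewrite /nbin_sum !big_ord0 mulr0 add0n bin_small// mul0r subrr.
rewrite /nbin_sum !big_ord_recr/= -/(nbin_sum k M x) -/(nbin_sum k.+1 M x).
rewrite mulrDr IH addnS addSn binS natrD exprS.
ring.
Qed.

Lemma bin_le_exp2 n k : ('C(n, k) <= 2 ^ n)%N.
Proof.
elim: n k => [|n IH] [|k]//; rewrite ?bin0 ?expn_gt0//.
by rewrite binS expnS mul2n -addnn leq_add.
Qed.

(** The negative binomial series: by nbin_sumS the error at k + 1 is (1 - x)^(-1) times the
    sum of the error at k and a term that tends to 0 because C(M + k, k + 1) <= 2^(M + k)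
    and |x| < 1/2. *)
Lemma nbin_sum_cvg k x : normc x < 2^-1 -> 1 <= normc (1 - x) ->
  normc ((1 - x)^-1 ^+ k.+1 - nbin_sum k M x) @[M --> \oo] --> (0 : R).
Proof.
move=> x2 x1; set q := (1 - x)^-1.
have q0 : 1 - x != 0.
  by apply: contraL x1 => /eqP ->; rewrite Normc.normc0 ler10.
have nq : normc q <= 1 by rewrite Normc.normcV invf_le1// (lt_le_trans ltr01).
have geo : (2 * normc x) ^+ M @[M --> \oo] --> (0 : R).
  apply: cvg_expr; rewrite ger0_norm ?mulr_ge0 ?normc_ge0//.
  by rewrite mulrC -ltr_pdivlMr// mul1r.
elim: k => [|k IH].
  have E M : q ^+ 1 - nbin_sum 0 M x = q * x ^+ M.
    apply: (mulfI q0); rewrite mulrBr nbin_sum0 expr1 mulrA divff//.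
    by ring.
  apply: (squeeze_cvgr _ (cvg_cst 0) geo); near=> M.
  rewrite normc_ge0/= E Normc.normcM normcX.
  rewrite (le_trans (ler_piMl _ nq)) ?exprn_ge0 ?normc_ge0//.
  by apply: lerXn2r; rewrite ?nnegrE ?mulr_ge0 ?normc_ge0// ler_peMl ?normc_ge0// ler1n.
have E M : q ^+ k.+2 - nbin_sum k.+1 M x =
    q * (q ^+ k.+1 - nbin_sum k M x + 'C(M + k, k.+1)%:R * x ^+ M).
  apply: (mulfI q0); rewrite mulrBr nbin_sumS exprS !mulrA divff//.
  by ring.
have H : normc (q ^+ k.+1 - nbin_sum k M x) + 2 ^+ k * (2 * normc x) ^+ M
    @[M --> \oo] --> (0 : R).
  rewrite -[X in _ --> X](addr0 0); apply: cvgD => //.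
  by rewrite -[X in _ --> X](mulr0 (2 ^+ k)); apply: cvgM => //; exact: cvg_cst.
apply: (squeeze_cvgr _ (cvg_cst 0) H); near=> M.
rewrite normc_ge0/= E Normc.normcM (le_trans (ler_piMl _ nq)) ?normc_ge0//.
apply: (le_trans (le_normcD _ _)); rewrite lerD2l Normc.normcM normcX.
rewrite (_ : normc _%:R = ('C(M + k, k.+1))%:R); last first.
  by rewrite -(rmorph_nat (real_complex R)) normc_real ger0_norm.
rewrite exprMn mulrA -exprD ler_wpM2r ?exprn_ge0 ?normc_ge0//.
by rewrite -natrX ler_nat addnC bin_le_exp2.
Unshelve. all: by end_near. Qed.
End negative_binomial_series.

Section mittag_leffler_bound.
Variables (R : realType) (alpha : R).
Hypothesis alpha01 : 0 < alpha < 1.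
Local Open Scope complex_scope.
Notation normc := (@Normc.normc R).

Let alpha_gt0 : 0 < alpha. Proof. by case/andP: alpha01. Qed.
Let alpha_le1 : 0 < alpha <= 1.
Proof. by case/andP: alpha01 => -> /ltW. Qed.

(** For q = 1 / (1 - zeta), the coefficient of z^n in
    1 / ((1 - z)^alpha - zeta) = 1 / (1 - zeta - p(z)) = sum_k p(z)^k q^(k+1). Only k <= n
    contribute. *)
Definition sibuya_sum (n : nat) (q : R[i]) : R[i] :=
  \sum_(k < n.+1) (sibuya alpha n k)%:C * q ^+ k.+1.

(** The same function is also sum_m zeta^m (1 - z)^(- alpha (m + 1)); this is the power
    series in zeta that tends to a Mittag-Leffler series. *)
Lemma sibuya_sum_series n (x : R[i]) : normc x < 2^-1 -> 1 <= normc (1 - x) ->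
  normc (sibuya_sum n (1 - x)^-1 -
    \sum_(m < M) (rbin (alpha * m%:R + alpha) n)%:C * x ^+ m) @[M --> \oo] --> (0 : R).
Proof.
move=> x2 x1.
have E M : \sum_(m < M) (rbin (alpha * m%:R + alpha) n)%:C * x ^+ m =
    \sum_(k < n.+1) (sibuya alpha n k)%:C * nbin_sum k M x.
  under eq_bigr => m _.
    rewrite rbin_sibuya rmorph_sum mulr_suml.
    under eq_bigr do rewrite rmorphM rmorph_nat -mulrA.
    over.
  by rewrite exchange_big/=; apply: eq_bigr => k _; rewrite -mulr_sumr.
have H : \sum_(k < n.+1) sibuya alpha n k *
     normc ((1 - x)^-1 ^+ k.+1 - nbin_sum k M x) @[M --> \oo] --> (0 : R).
  rewrite [X in _ --> X](_ : 0 = \sum_(k < n.+1) sibuya alpha n k * 0); last first.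
    by rewrite big1// => k _; rewrite mulr0.
  apply: (cvg_big (op := +%R)) => [|k _]; first exact: add_continuous.
  apply: cvgM; first exact: cvg_cst.
  exact: nbin_sum_cvg.
apply: (squeeze_cvgr _ (cvg_cst 0) H); near=> M.
rewrite normc_ge0/= E /sibuya_sum -sumrB (le_trans (normc_sum _ _ _))//.
apply: ler_sum => k _; rewrite -mulrBr Normc.normcM normc_real ger0_norm//.
exact: sibuya_ge0.
Unshelve. all: by end_near. Qed.

Lemma sibuya_sum_le n (q : R[i]) : normc q <= 1 -> normc (sibuya_sum n q) <= rbin alpha n.
Proof.
move=> q1; have := rbin_sibuya alpha n 0; rewrite mulr0 add0r => ->.
apply: (le_trans (normc_sum _ _ _)); apply: ler_sum => k _.
rewrite add0n binn mulr1 Normc.normcM normcX normc_real ger0_norm ?sibuya_ge0//.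
by rewrite ler_piMr ?sibuya_ge0// exprn_ile1// normc_ge0.
Qed.

(** Summation by parts trades the factor 1 - q for differences of the weights. *)
Lemma sibuya_sum_abel n (q : R[i]) : normc q <= 1 ->
  normc ((1 - q) * sibuya_sum n q) <= normc q * sibuya_var alpha n.
Proof.
move=> q1.
have -> : (1 - q) * sibuya_sum n q = \sum_(k < n.+2) (dsibuya alpha n k)%:C * q ^+ k.+1.
  rewrite mulrBl mul1r /sibuya_sum.
  have -> : \sum_(k < n.+1) (sibuya alpha n k)%:C * q ^+ k.+1 =
      \sum_(k < n.+2) (sibuya alpha n k)%:C * q ^+ k.+1.
    by rewrite [RHS]big_ord_recr/= (sibuya_gt _ (ltnSn n)) rmorph0 mul0r addr0.
  rewrite [X in _ - _ * X]big_ord_recr/= (sibuya_gt _ (ltnSn n)) rmorph0 mul0r addr0.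
  rewrite big_ord_recl [RHS]big_ord_recl/= /dsibuya subr0 -addrA; congr (_ + _).
  rewrite mulr_sumr -sumrB; apply: eq_bigr => k _.
  by rewrite /bump/= add1n add0n rmorphB [q ^+ k.+2]exprS /=; ring.
apply: (le_trans (normc_sum _ _ _)); rewrite mulr_sumr; apply: ler_sum => k _.
rewrite Normc.normcM normcX normc_real exprS mulrCA ler_wpM2l ?normc_ge0//.
by rewrite ler_piMr// exprn_ile1// normc_ge0.
Qed.

Lemma rcoefE (n m : nat) (z : R[i]) : (0 < n)%N ->
  (rcoef alpha n m)%:C * z ^+ m =
  (n%:R / n%:R `^ alpha)%:C *
    ((rbin (alpha * m%:R + alpha) n)%:C * (z / (n%:R `^ alpha)%:C) ^+ m).
Proof.
move=> n0; have n0' : n%:R != 0 :> R by rewrite pnatr_eq0 -lt0n.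
have p0 : n%:R `^ alpha != 0 :> R by rewrite powR_eq0 (negbTE n0').
have p0' : (n%:R `^ alpha)%:C != 0 by rewrite fmorph_eq0.
rewrite /rcoef powRD ?n0' ?implybT// powRrM powR_mulrn ?powR_ge0//.
rewrite exprMn exprVn !rmorphM/= !fmorphV/= rmorphM/= rmorphXn/=.
by field; rewrite p0' expf_neq0.
Qed.

(** At zeta = - i y / n^alpha, the factor n^(1 - alpha) is the one that makes sibuya_sum
    converge to E_{alpha,alpha}(- i y). As |q| <= 1, the sum is at most the total mass
    rbin alpha n of its nonnegative weights, of order n^(alpha - 1). As 1 - q = - zeta q,
    summation by parts bounds |zeta| times the sum by the total variation, of order 1 / n. *)
Lemma sibuya_sum_bound : exists2 B : R, 0 < B & forall y : R,
  exists N, forall n : nat, (N <= n)%N ->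
    let q := (1 - - ('i * (y / n%:R `^ alpha)%:C))^-1 in
    n%:R / n%:R `^ alpha * normc (sibuya_sum n q) <= B /\
    `|y| * (n%:R / n%:R `^ alpha * normc (sibuya_sum n q)) <= B.
Proof.
have [N [C HC]] := sibuya_var_bounded alpha01.
exists (`|C| + alpha * (1 + alpha)).
  by rewrite ltr_wpDl// mulr_gt0// addr_gt0.
move=> y; exists (maxn N 2) => n; rewrite geq_max => /andP[Nn n2] q.
have n0 : 0 < n%:R :> R by rewrite ltr0n (leq_trans _ n2).
have p0 : 0 < n%:R `^ alpha :> R by rewrite powR_gt0.
have q1 : normc q <= 1.
  rewrite Normc.normcV invf_le1 ?normc_1Dimag//.
  by rewrite (lt_le_trans ltr01)// normc_1Dimag.
have f0 : 0 <= n%:R / n%:R `^ alpha :> R by rewrite divr_ge0 ?powR_ge0.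
split.
  apply: (@le_trans _ _ (alpha * (1 + alpha))); last by rewrite lerDr.
  apply: (@le_trans _ _ (n%:R / n%:R `^ alpha * rbin alpha n)).
    by rewrite ler_wpM2l// sibuya_sum_le.
  have h := @rbin_le R alpha 1 n alpha_gt0 n2.
  by rewrite mulrAC (le_trans h)// expr1 powR1 divr1.
apply: (@le_trans _ _ `|C|); last by rewrite lerDl mulr_ge0 ?addr_ge0// ltW.
apply: le_trans (ler_norm C); apply: le_trans (HC _ Nn).
set w : R[i] := - ('i * (y / n%:R `^ alpha)%:C) in q q1 *.
have w0 : 1 - w != 0.
  by apply: contraTneq (normc_1Dimag (y / n%:R `^ alpha)) => ->; rewrite Normc.normc0 ler10.
have qw : 1 - q = - w * q.
  by apply: (mulIf w0); rewrite /q mulrBl -mulrA mulVf// mul1r mulr1; ring.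
have q0 : 0 < normc q by rewrite Normc.normcV invr_gt0 (lt_le_trans ltr01)// normc_1Dimag.
have := sibuya_sum_abel n q1; rewrite qw -mulrA mulrCA Normc.normcM ler_pM2l//.
rewrite Normc.normcM normc_opp normc_imag normrM [`|_^-1|]gtr0_norm ?invr_gt0// => h.
have -> : `|y| * (n%:R / n%:R `^ alpha * normc (sibuya_sum n q)) =
    n%:R * (`|y| / n%:R `^ alpha * normc (sibuya_sum n q)) by ring.
by rewrite ler_wpM2l.
Qed.

(** S, the n-th discrete approximation, is the sum of a convergent series. Truncating this
    series at M costs a geometric tail, uniformly in n; for M fixed, n tends to infinity. *)
Lemma mittag_leffler_partial_bound (x B : R) (z : R[i]) : normc z = x ->
  (exists N, forall n : nat, (N <= n)%N -> exists S : R[i],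
     normc S <= B /\
     normc (S - \sum_(m < M) (rcoef alpha n m)%:C * z ^+ m) @[M --> \oo] --> (0 : R)) ->
  exists2 K : R, (forall m, (Gamma (alpha * m%:R + alpha))^-1 * x ^+ m <= K * 2^-1 ^+ m) &
    forall M, normc (\sum_(m < M) ((Gamma (alpha * m%:R + alpha))^-1)%:C * z ^+ m)
      <= B + 2 * K * 2^-1 ^+ M.
Proof.
move=> zx [N HN].
have x0 : 0 <= x by rewrite -zx normc_ge0.
have [J [K [K0 HK]]] := rcoef_geometric alpha_le1 x0.
have cvm m := @rcoef_cvg R alpha m alpha_gt0.
exists K => [m|M].
  have h : rcoef alpha n.+1 m * x ^+ m @[n --> \oo] -->
      (Gamma (alpha * m%:R + alpha))^-1 * x ^+ m.
    by apply: cvgM => //; exact: cvg_cst.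
  rewrite -(cvg_lim _ h)//; apply: limr_le; first by apply/cvg_ex; eexists; exact: h.
  near=> n; apply: HK; near: n; exists J => // n /=; by rewrite ltnS.
apply/ler_addgt0Pr => eps eps0.
have e2 : 0 < eps / 2 by rewrite divr_gt0.
(* n so large that the first M coefficients are close to their limits *)
have h : \sum_(m < M) `|rcoef alpha n.+1 m - (Gamma (alpha * m%:R + alpha))^-1| * x ^+ m
    @[n --> \oo] --> (0 : R).
  rewrite [X in _ --> X](_ : 0 = \sum_(m < M)
      `|(Gamma (alpha * m%:R + alpha))^-1 - (Gamma (alpha * m%:R + alpha))^-1| * x ^+ m); last first.
    by rewrite big1// => k _; rewrite subrr normr0 mul0r.
  apply: (cvg_big (op := +%R)) => [|k _]; first exact: add_continuous.
  apply: cvgM; last exact: cvg_cst.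
  by apply: cvg_norm; apply: cvgB => //; exact: cvg_cst.
have [n [Nn Jn hn]] : exists n, [/\ (N <= n.+1)%N, (J < n.+1)%N &
    \sum_(m < M) `|rcoef alpha n.+1 m - (Gamma (alpha * m%:R + alpha))^-1| * x ^+ m < eps / 2].
  have [n0 _ Hn0] := (cvgr0_norm_lt _ h) _ e2.
  exists (maxn n0 (maxn N J)); split.
  - by rewrite ltnW// ltnS !leq_max leqnn orbT.
  - by rewrite ltnS !leq_max leqnn !orbT.
  - apply: le_lt_trans (ler_norm _) (Hn0 _ _); by rewrite /= leq_max leqnn.
have [S [SB cS]] := HN _ Nn.
have [M1 _ HM1] := (cvgr0_norm_lt _ cS) _ e2.
pose M' := maxn M M1.
have MM' : (M <= M')%N by rewrite leq_maxl.
have := HM1 M' (leq_maxr _ _).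
rewrite ger0_norm ?normc_ge0// => hS.
pose Tn L := \sum_(m < L) (rcoef alpha n.+1 m)%:C * z ^+ m.
have tail : normc (Tn M' - Tn M) <= 2 * K * 2^-1 ^+ M.
  rewrite /Tn -!(big_mkord xpredT (fun m => (rcoef alpha n.+1 m)%:C * z ^+ m)).
  rewrite (@big_cat_nat _ _ _ M 0 M')//= addrAC subrr add0r.
  apply: (le_trans (normc_sum _ _ _)).
  apply: (@le_trans _ _ (\sum_(M <= m < M') K * 2^-1 ^+ m)).
    apply: ler_sum => m _; rewrite Normc.normcM normcX zx normc_real.
    by rewrite ger0_norm ?rcoef_ge0// HK.
  have geo : \sum_(M <= m < M') K * 2^-1 ^+ m = 2 * K * (2^-1 ^+ M - 2^-1 ^+ M').
    move: MM'; elim: (M') => [|L IH].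
      by rewrite leqn0 => /eqP ->; rewrite big_nil subrr mulr0.
    rewrite leq_eqVlt => /predU1P[<-|]; first by rewrite big_geq// subrr mulr0.
    by rewrite ltnS => ML; rewrite big_nat_recr//= IH// exprS; field.
  rewrite geo ler_wpM2l ?mulr_ge0 ?(ltW K0)// gerBl exprn_ge0//.
have near1 : normc (\sum_(m < M) ((Gamma (alpha * m%:R + alpha))^-1)%:C * z ^+ m - Tn M)
    <= eps / 2.
  rewrite /Tn -sumrB; apply: (le_trans (normc_sum _ _ _)).
  apply: le_trans (ltW hn); apply: ler_sum => m _.
  rewrite -mulrBl Normc.normcM normcX zx -rmorphB normc_real distrC//.
rewrite [X in normc X](_ : _ = (\sum_(m < M) ((Gamma (alpha * m%:R + alpha))^-1)%:C * z ^+ m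
   - Tn M) + (S - (S - Tn M') - (Tn M' - Tn M))); last by ring.
apply: (le_trans (le_normcD _ _)).
have h1 : normc (S - (S - Tn M') - (Tn M' - Tn M)) <= B + eps / 2 + 2 * K * 2^-1 ^+ M.
  apply: (le_trans (le_normcD _ _)); rewrite normc_opp lerD//.
  apply: (le_trans (le_normcD _ _)); rewrite normc_opp lerD//.
  exact: ltW.
by move: near1 h1; lra.
Unshelve. all: by end_near. Qed.

(** The factor 2 comes from bounding the real and the imaginary part separately. *)
Lemma mittag_leffler_bound (B : R) (z : R[i]) :
  (exists N, forall n : nat, (N <= n)%N -> exists S : R[i],
     normc S <= B /\
     normc (S - \sum_(m < M) (rcoef alpha n m)%:C * z ^+ m) @[M --> \oo] --> (0 : R)) ->
  normc (mittag_leffler alpha alpha z) <= 2 * B.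
Proof.
move=> H; have [K HK HB] := mittag_leffler_partial_bound (erefl (normc z)) H.
have G0 m : 0 <= (Gamma (alpha * m%:R + alpha))^-1.
  by rewrite invr_ge0 ltW// Gamma_gt0// ltr_wpDl// mulr_ge0// ltW.
have tE m : mittag_leffler_term alpha alpha z m =
    ((Gamma (alpha * m%:R + alpha))^-1)%:C * z ^+ m.
  by rewrite /mittag_leffler_term mulrC -fmorphV.
have tn m : normc (mittag_leffler_term alpha alpha z m) <= K * 2^-1 ^+ m.
  by rewrite tE Normc.normcM normcX normc_real ger0_norm.
have geo : cvgn (series (fun m => K * (2^-1 : R) ^+ m)).
  by apply: is_cvg_geometric_series; rewrite ger0_norm ?invr_ge0// invf_lt1// ltr1n.
have K2 : 2 * K * 2^-1 ^+ M @[M --> \oo] --> (0 : R).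
  rewrite -[X in _ --> X](mulr0 (2 * K)); apply: cvgM; first exact: cvg_cst.
  by apply: cvg_expr; rewrite ger0_norm ?invr_ge0// invf_lt1// ltr1n.
have HBl : B + 2 * K * 2^-1 ^+ M @[M --> \oo] --> B.
  by rewrite -[X in _ --> X]addr0; apply: cvgD => //; exact: cvg_cst.
have aux (f : R[i] -> R) : (forall x, `|f x| <= normc x) ->
    (forall M (F : nat -> R[i]), f (\sum_(m < M) F m) = \sum_(m < M) f (F m)) ->
    `|limn (series (fun n => f (mittag_leffler_term alpha alpha z n)))| <= B.
  move=> fn fs.
  have cv : cvgn (series (fun n => f (mittag_leffler_term alpha alpha z n))).
    apply: normed_cvg; apply: series_le_cvg geo => n /=.
    - exact: normr_ge0.
    - by rewrite (le_trans (normc_ge0 _) (tn n)).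
    - exact: le_trans (fn _) (tn n).
  rewrite -(cvg_lim _ (cvg_norm cv))// -(cvg_lim _ HBl)//.
  apply: ler_lim.
  - by apply/cvg_ex; eexists; exact: cvg_norm cv.
  - by apply/cvg_ex; eexists; exact: HBl.
  near=> M; rewrite /= /series/= big_mkord -fs.
  apply: (le_trans (fn _)); apply: le_trans (HB M).
  by under eq_bigr do rewrite tE.
apply: (le_trans (normc_le_ReIm _)); rewrite mulr_natl mulr2n lerD//=.
- by apply: aux => [x|M F]; [exact: normc_ge_absRe|exact: Re_sum].
- by apply: aux => [x|M F]; [exact: normc_ge_absIm|exact: Im_sum].
Unshelve. all: by end_near. Qed.

(** For y <> 0 the second bound is the first argument run with B / |y| in place of B. *)
Theorem mittag_leffler_imag_bound : exists2 B : R, 0 < B & forall y : R,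
  normc (mittag_leffler alpha alpha (- ('i * y%:C))) <= B /\
  `|y| * normc (mittag_leffler alpha alpha (- ('i * y%:C))) <= B.
Proof.
have [B B0 HB] := sibuya_sum_bound; exists (2 * B); first by rewrite mulr_gt0.
move=> y; have [N HN] := HB y.
set z : R[i] := - ('i * y%:C).
have nz : normc z = `|y| by rewrite normc_imag.
(* zeta = z / n^alpha must fall in the disc where the series in zeta converges *)
have large : exists N1, forall n : nat, (N1 <= n)%N ->
    [/\ (0 < n)%N, (N <= n)%N & `|y| / n%:R `^ alpha < 2^-1].
  pose N1 := (Num.truncn ((2 * `|y|) `^ alpha^-1)).+1.
  exists (maxn N N1) => n; rewrite geq_max => /andP[Nn N1n].
  have n0 : (0 < n)%N by apply: leq_trans N1n.
  split => //; rewrite ltr_pdivrMr ?powR_gt0 ?ltr0n// mulrC ltr_pdivlMr// mulrC.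
  have y2 : 0 <= 2 * `|y| by rewrite mulr_ge0.
  have -> : 2 * `|y| = ((2 * `|y|) `^ alpha^-1) `^ alpha.
    by rewrite -powRrM mulVf ?gt_eqF// powRr1.
  apply: gt0_ltr_powR; rewrite ?nnegrE ?powR_ge0//.
  by rewrite (lt_le_trans (truncnS_gt _))// ler_nat.
have [N1 HN1] := large.
pose S n := (n%:R / n%:R `^ alpha)%:C *
  sibuya_sum n (1 - - ('i * (y / n%:R `^ alpha)%:C))^-1.
have SE n : (0 < n)%N ->
   normc (S n) = n%:R / n%:R `^ alpha *
    normc (sibuya_sum n (1 - - ('i * (y / n%:R `^ alpha)%:C))^-1).
  by move=> n0; rewrite Normc.normcM normc_real ger0_norm// divr_ge0 ?powR_ge0.
have ScV n : (N1 <= n)%N ->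
    normc (S n - \sum_(m < M) (rcoef alpha n m)%:C * z ^+ m) @[M --> \oo] --> (0 : R).
  move=> /HN1 [n0 _ yn].
  have p0 : 0 < n%:R `^ alpha :> R by rewrite powR_gt0// ltr0n.
  pose w : R[i] := - ('i * (y / n%:R `^ alpha)%:C).
  have zw : z / (n%:R `^ alpha)%:C = w.
    by rewrite /w /z rmorphM/= fmorphV mulNr mulrA.
  have w2 : normc w < 2^-1 by rewrite normc_imag normrM [X in _ * X]gtr0_norm ?invr_gt0.
  pose f M := normc (sibuya_sum n (1 - w)^-1 -
    \sum_(m < M) (rbin (alpha * m%:R + alpha) n)%:C * w ^+ m).
  have cf : f M @[M --> \oo] --> (0 : R).
    exact: sibuya_sum_series w2 (normc_1Dimag _).
  have -> : (fun M => normc (S n - \sum_(m < M) (rcoef alpha n m)%:C * z ^+ m)) =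
      (fun M => n%:R / n%:R `^ alpha * f M).
    apply/funext => M; under eq_bigr do rewrite rcoefE// zw.
    rewrite -mulr_sumr /S -mulrBr Normc.normcM normc_real ger0_norm// divr_ge0// ltW.
  by rewrite -[X in _ --> X](mulr0 (n%:R / n%:R `^ alpha)); apply: cvgM => //; exact: cvg_cst.
split.
  apply: mittag_leffler_bound; exists N1 => n Nn; exists (S n); split; last exact: ScV.
  have [n0 Nn' _] := HN1 _ Nn.
  by rewrite SE//; have [] := HN _ Nn'.
have [->|y0] := eqVneq y 0; first by rewrite normr0 mul0r mulr_ge0 ?(ltW B0).
rewrite mulrC -ler_pdivlMr ?normr_gt0// -mulrA.
apply: mittag_leffler_bound; exists N1 => n Nn; exists (S n); split; last exact: ScV.
have [n0 Nn' _] := HN1 _ Nn.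
rewrite SE// ler_pdivlMr ?normr_gt0// mulrC.
by have [] := HN _ Nn'.
Qed.
End mittag_leffler_bound.

(** * Integrals of functions that may not be measurable *)

Section lower_integral.
Context d (T : measurableType d) (R : realType).
Variable mu : {measure set T -> \bar R}.

(** The integral of a nonnegative function is a supremum over the simple functions below
    it, so it is monotone even when the functions are not measurable. *)
Lemma ge0_le_integral_nomeas (D : set T) (f g : T -> \bar R) :
  (forall x, D x -> 0 <= f x)%E -> (forall x, D x -> f x <= g x)%E ->
  (\int[mu]_(x in D) f x <= \int[mu]_(x in D) g x)%E.
Proof.
move=> f0 fg; have g0 x : (D x -> 0 <= g x)%E by move=> Dx; rewrite (le_trans (f0 _ Dx)) ?fg.
rewrite !ge0_integralE//; apply: le_ereal_sup => _ [h /= hf <-].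
exists h => //= x; apply: (le_trans (hf x)).
by rewrite /patch; case: ifPn => // /set_mem; exact: fg.
Qed.

(** f need not be measurable, so its values on N cannot be removed; instead g is raised to
    +oo on N, which does not change its integral. *)
Lemma ae_ge0_le_integral_nomeas (D N : set T) (f g : T -> \bar R) :
  measurable D -> measurable N -> mu N = 0%E -> measurable_fun D g ->
  (forall x, D x -> 0 <= f x)%E -> (forall x, D x -> 0 <= g x)%E ->
  (forall x, D x -> ~ N x -> f x <= g x)%E ->
  (\int[mu]_(x in D) f x <= \int[mu]_(x in D) g x)%E.
Proof.
move=> mD mN N0 mg f0 g0 fg.
pose g' x := (if x \in N then +oo else g x)%E.
have mg' : measurable_fun D g'.
  apply: measurable_fun_if => //.
  - apply: (@measurable_fun_bool _ _ _ _ true).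
    rewrite (_ : _ @^-1` _ = N); first exact: measurableI.
    by apply/seteqP; split => x /= => [/set_mem|/mem_set].
  - by apply: measurable_funS mg => //; exact: subIsetl.
apply: (@le_trans _ _ (\int[mu]_(x in D) g' x)%E).
  apply: ge0_le_integral_nomeas => // x Dx; rewrite /g'; case: ifPn => [_|].
    by rewrite leey.
  by rewrite notin_setE; exact: fg.
rewrite le_eqVlt; apply/orP; left; apply/eqP.
apply: ge0_ae_eq_integral => //.
  by move=> x Dx; rewrite /g'; case: ifPn => // _; exact: g0.
exists N; split => // x /= /not_implyP[Dx]; rewrite /g'.
by case: ifPn => // /set_mem.
Qed.

(** Used for integrands that involve the indicator function of G0, which is measurable
    only for the completed measure. *)
Lemma normr_Rintegral_le_dominated (D N : set T) (f g : T -> R) :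
  measurable D -> measurable N -> mu N = 0%E -> mu.-integrable D (EFin \o g) ->
  (forall x, D x -> 0 <= g x) ->
  (forall x, D x -> ~ N x -> `|f x| <= g x) ->
  `|\int[mu]_(x in D) f x| <= \int[mu]_(x in D) g x.
Proof.
move=> mD mN N0 ig g0 fg.
have mg := measurable_int _ ig.
have gfin := integrable_fin_num mD ig.
have g0' x : D x -> (0 <= (EFin \o g) x)%E by move=> Dx; rewrite lee_fin g0.
have hp : (\int[mu]_(x in D) (EFin \o f)^\+ x <= \int[mu]_(x in D) (g x)%:E)%E.
  apply: (ae_ge0_le_integral_nomeas mD mN N0) => // x Dx Nx.
  by rewrite funeposE/= -EFin_max lee_fin ge_max g0// (le_trans (ler_norm _))// fg.
have hn : (\int[mu]_(x in D) (EFin \o f)^\- x <= \int[mu]_(x in D) (g x)%:E)%E.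
  apply: (ae_ge0_le_integral_nomeas mD mN N0) => // x Dx Nx.
  rewrite funenegE/= -EFin_max lee_fin ge_max g0//.
  by rewrite (le_trans (ler_norm _))// normrN fg.
have p0 : (0 <= \int[mu]_(x in D) (EFin \o f)^\+ x)%E by apply: integral_ge0.
have n0 : (0 <= \int[mu]_(x in D) (EFin \o f)^\- x)%E by apply: integral_ge0.
have pfin : (\int[mu]_(x in D) (EFin \o f)^\+ x)%E \is a fin_num.
  by rewrite ge0_fin_numE// (le_lt_trans hp)// ltey_eq gfin.
have nfin : (\int[mu]_(x in D) (EFin \o f)^\- x)%E \is a fin_num.
  by rewrite ge0_fin_numE// (le_lt_trans hn)// ltey_eq gfin.
rewrite /Rintegral integralE fineB//.
move: hp hn; rewrite -(fineK pfin) -(fineK nfin) -(fineK gfin) !lee_fin.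
move: (fine_ge0 p0) (fine_ge0 n0); rewrite ler_norml.
move=> ? ? ? ?; apply/andP; split; lra.
Qed.
End lower_integral.

(** * Borel sets of the row space *)

(** The measurable sets are generated by the coordinates: an open set is the union of the
    boxes with rational centre and radius 1 / (m + 1) that it contains, and they are
    countably many. *)
Lemma row_open_measurable (R : realType) (n : nat) (A : set 'rV[R]_n) :
  open A -> measurable A.
Proof.
move=> oA.
pose bx (p : nat * 'rV[rat]_n) : set 'rV[R]_n :=
  row_box (\row_i (ratr (p.2 ord0 i) - p.1.+1%:R^-1)) (\row_i (ratr (p.2 ord0 i) + p.1.+1%:R^-1)).
pose F (k : nat) : set 'rV[R]_n :=
  if unpickle k is Some p then (if `[< bx p `<=` A >] then bx p else set0) else set0.
have -> : A = \bigcup_k F k.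
  apply/seteqP; split => x.
    move=> Ax; have /nbhs_ballP[e /= e0 eA] : nbhs x A by exact: open_nbhs_nbhs.
    (* a box of radius r around a point at distance less than r stays within 2 r < e *)
    pose m := Num.truncn (2 / e).
    have m0 : 0 < m.+1%:R^-1 :> R by rewrite invr_gt0.
    have me : m.+1%:R^-1 + m.+1%:R^-1 < e.
      rewrite -[X in X + X]mul1r -mulrDl ltr_pdivrMr ?ltr0n// mulrC -ltr_pdivrMr//.
      exact: truncnS_gt.
    have [r rE] : exists r : R, r = m.+1%:R^-1 by eexists.
    rewrite -rE in m0 me.
    have hq i : {q : rat | `|ratr q - x ord0 i| < r}.
      apply: cid; have [|q] := @rat_in_itvoo R (x ord0 i - r) (x ord0 i + r); first lra.
      by rewrite in_itv/= => /andP[q1 q2]; exists q; rewrite ltr_norml; lra.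
    pose p : nat * 'rV[rat]_n := (m, \row_i sval (hq i)).
    have xp i : `|ratr (p.2 ord0 i) - x ord0 i| < r.
      by rewrite /p/= mxE; exact: (svalP (hq i)).
    exists (pickle p) => //; rewrite /F pickleK; case: asboolP => [_|].
      by move=> i; have := xp i; rewrite !mxE -rE ltr_norml; lra.
    case=> y yb; apply: eA; split=> // i j; rewrite (ord1 i) /ball/=.
    by have := yb j; have := xp j; rewrite !mxE -rE !ltr_norml; lra.
  case=> k _; rewrite /F; case: (unpickle k) => // p; case: asboolP => // h; exact: h.
apply: bigcup_measurable => k _; rewrite /F; case: (unpickle k) => // p.
by case: ifP => // _; exact: measurable_row_box.
Qed.

Lemma row_bounded_lty (R : realType) (n : nat) (A : set 'rV[R]_n) :
  measurable A -> bounded_set A -> (row_lebesgue R n A < +oo)%E.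
Proof.
move=> mA [M [_ bA]].
have {}bA x : A x -> `|x| <= `|M| + 1.
  by move=> Ax; apply: bA => //; rewrite (le_lt_trans (ler_norm M))// ltrDl.
pose c := `|M| + 1.
have c0 : 0 <= c by rewrite addr_ge0.
apply: (@le_lt_trans _ _ (row_lebesgue R n (row_box (\row_i (- c)) (\row_i c)))).
  apply: le_measure; rewrite ?inE//; first exact: measurable_row_box.
  move=> x /bA xc i; rewrite !mxE -ler_norml.
  apply: le_trans xc; rewrite [leRHS]mx_normrE.
  exact: (le_bigmax _ (fun ij => `|x ij.1 ij.2|) (ord0, i)).
rewrite row_lebesgue_box ?ltry// => i; rewrite !mxE.
by rewrite (@le_trans _ _ 0)// oppr_le0.
Qed.

(** * Square-integrable functions *)

Section L2_theory.
Variables (R : realType) (d : nat) (G : set 'rV[R]_d).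
Hypothesis mG : measurable G.
Local Open Scope complex_scope.
Notation normc := (@Normc.normc R).
Notation mu := (row_lebesgue R d).
Implicit Types f g h : 'rV[R]_d -> R[i].

Lemma measurable_sqr_normc f : cmeasurable_fun G f ->
  measurable_fun G (fun x => normc (f x) ^+ 2).
Proof.
move=> [mr mi]; under eq_fun do rewrite normc_sqr.
by apply: measurable_funD; apply: measurable_funX.
Qed.

Let integrable_scale (a : R) (u : 'rV[R]_d -> R) :
  mu.-integrable G (EFin \o u) -> mu.-integrable G (EFin \o (fun x => a * u x)).
Proof. by move=> iu; have := integrableZl mG a iu. Qed.

Let integrable_add (u v : 'rV[R]_d -> R) :
  mu.-integrable G (EFin \o u) -> mu.-integrable G (EFin \o v) ->
  mu.-integrable G (EFin \o (fun x => u x + v x)).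
Proof. by move=> iu iv; have := integrableD mG iu iv. Qed.

Lemma L2_integrable f : L2 G f ->
  mu.-integrable G (EFin \o (fun x => normc (f x) ^+ 2)).
Proof.
move=> [mf foo]; apply/integrableP; split.
  by apply/measurable_EFinP; exact: measurable_sqr_normc.
by under eq_integral do rewrite gee0_abs ?lee_fin ?sqr_ge0//.
Qed.

Lemma L2_0 : L2 G (fun=> 0).
Proof.
split; first by split; exact: measurable_cst.
by under eq_integral do rewrite Normc.normc0 expr0n/=; rewrite integral0 ltry.
Qed.

Lemma L2D f g : L2 G f -> L2 G g -> L2 G (fun x => f x + g x).
Proof.
move=> Lf Lg; have [[mf1 mf2] _] := Lf; have [[mg1 mg2] _] := Lg.
have mfg : cmeasurable_fun G (fun x => f x + g x).
  split; [under eq_fun do rewrite ReD|under eq_fun do rewrite ImD];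
  exact: measurable_funD.
split => //.
have i2 : mu.-integrable G (EFin \o (fun x => 2 * normc (f x) ^+ 2 + 2 * normc (g x) ^+ 2)).
  by apply: integrable_add; apply: integrable_scale; exact: L2_integrable.
have /integrableP[_] := i2; apply: le_lt_trans; apply: ge0_le_integral_nomeas => x _ /=.
  by rewrite lee_fin sqr_ge0.
have p2 (a : R) : 0 <= 2 * a ^+ 2 by apply: mulr_ge0; rewrite ?sqr_ge0.
rewrite lee_fin ger0_norm ?addr_ge0 ?p2//.
have := le_normcD (f x) (g x); move: (normc_ge0 (f x + g x)) => h0 h1.
apply: (@le_trans _ _ ((normc (f x) + normc (g x)) ^+ 2)).
  by apply: lerXn2r => //; rewrite nnegrE ?addr_ge0 ?normc_ge0.
have := sqr_ge0 (normc (f x) - normc (g x)); rewrite sqrrB sqrrD; lra.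
Qed.

Lemma L2Z (c : R[i]) f : L2 G f -> L2 G (fun x => c * f x).
Proof.
move=> Lf; have [[mf1 mf2] _] := Lf.
split.
  split.
    under eq_fun do rewrite Re_mul; apply: measurable_funB; exact: measurable_funM.
  under eq_fun do rewrite Im_mul; apply: measurable_funD; exact: measurable_funM.
under eq_integral do rewrite Normc.normcM exprMn EFinM.
have /integrableP[_] := integrableZl mG (normc c ^+ 2) (L2_integrable Lf).
under eq_integral => x _ do rewrite gee0_abs ?mule_ge0 ?lee_fin ?sqr_ge0//.
by [].
Qed.

Lemma L2_sum (N : nat) (F : nat -> 'rV[R]_d -> R[i]) :
  (forall n, L2 G (F n)) -> L2 G (fun x => \sum_(n < N) F n x).
Proof.
move=> LF; elim: N => [|N IH]; first by under eq_fun do rewrite big_ord0; exact: L2_0.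
by under eq_fun do rewrite big_ord_recr/=; exact: L2D.
Qed.

Lemma L2B f g : L2 G f -> L2 G g -> L2 G (fun x => f x - g x).
Proof.
move=> Lf Lg; under eq_fun do rewrite -mulN1r.
by apply: L2D => //; exact: L2Z.
Qed.

Lemma integrable_L2M f h : L2 G f -> L2 G h ->
  mu.-integrable G (EFin \o (fun x => complex.Re (f x * conjc (h x)))) /\
  mu.-integrable G (EFin \o (fun x => complex.Im (f x * conjc (h x)))).
Proof.
move=> Lf Lh; have [[mf1 mf2] _] := Lf; have [[mh1 mh2] _] := Lh.
have i2 : mu.-integrable G (EFin \o (fun x => normc (f x) ^+ 2 + normc (h x) ^+ 2)).
  by apply: integrable_add; exact: L2_integrable.
have b x : normc (f x * conjc (h x)) <= normc (f x) ^+ 2 + normc (h x) ^+ 2.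
  rewrite Normc.normcM normc_conj.
  have := sqr_ge0 (normc (f x) - normc (h x)); rewrite sqrrB.
  have := mulr_ge0 (normc_ge0 (f x)) (normc_ge0 (h x)); lra.
split; apply: (le_integrable mG _ _ i2) => /=.
- apply/measurable_EFinP; under eq_fun do rewrite Re_mul Re_conj Im_conj.
  by apply: measurable_funB; apply: measurable_funM => //; exact: measurableT_comp.
- move=> x _; rewrite lee_fin [leRHS]ger0_norm ?addr_ge0 ?sqr_ge0//.
  exact: le_trans (normc_ge_absRe _) (b x).
- apply/measurable_EFinP; under eq_fun do rewrite Im_mul Re_conj Im_conj.
  by apply: measurable_funD; apply: measurable_funM => //; exact: measurableT_comp.
- move=> x _; rewrite lee_fin [leRHS]ger0_norm ?addr_ge0 ?sqr_ge0//.
  exact: le_trans (normc_ge_absIm _) (b x).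
Qed.

Lemma L2innerD f g h : L2 G f -> L2 G g -> L2 G h ->
  L2inner G (fun x => f x + g x) h = L2inner G f h + L2inner G g h.
Proof.
move=> Lf Lg Lh; have [f1 f2] := integrable_L2M Lf Lh; have [g1 g2] := integrable_L2M Lg Lh.
rewrite /L2inner /cintegral.
under eq_Rintegral do rewrite mulrDl ReD.
under [X in _ +i* X]eq_Rintegral do rewrite mulrDl ImD.
by rewrite !RintegralD.
Qed.

Lemma L2innerZ c f h : L2 G f -> L2 G h ->
  L2inner G (fun x => c * f x) h = c * L2inner G f h.
Proof.
move=> Lf Lh; have [f1 f2] := integrable_L2M Lf Lh.
rewrite /L2inner /cintegral.
under eq_Rintegral do rewrite -mulrA Re_mul.
under [X in _ +i* X]eq_Rintegral do rewrite -mulrA Im_mul.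
rewrite RintegralB//; [|exact: integrable_scale|exact: integrable_scale].
rewrite RintegralD//; [|exact: integrable_scale|exact: integrable_scale].
by rewrite !RintegralZl//; case: c.
Qed.

Lemma L2inner0 h : L2inner G (fun=> 0) h = 0.
Proof.
rewrite /L2inner /cintegral.
under eq_Rintegral do rewrite mul0r.
under [X in _ +i* X]eq_Rintegral do rewrite mul0r.
by rewrite /Rintegral !integral0.
Qed.

Lemma L2inner_sum (N : nat) (F : nat -> 'rV[R]_d -> R[i]) h :
  (forall n, L2 G (F n)) -> L2 G h ->
  L2inner G (fun x => \sum_(n < N) F n x) h = \sum_(n < N) L2inner G (F n) h.
Proof.
move=> LF Lh; elim: N => [|N IH].
  by rewrite big_ord0; under eq_fun do rewrite big_ord0; exact: L2inner0.
rewrite big_ord_recr/= -IH -L2innerD//; last exact: L2_sum.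
by congr L2inner; apply/funext => x; rewrite big_ord_recr.
Qed.

Lemma L2innerB f g h : L2 G f -> L2 G g -> L2 G h ->
  L2inner G (fun x => f x - g x) h = L2inner G f h - L2inner G g h.
Proof.
move=> Lf Lg Lh; under eq_fun do rewrite -mulN1r.
by rewrite L2innerD// ?L2innerZ ?mulN1r//; exact: L2Z.
Qed.

Lemma L2norm_sqr f : L2norm G f ^+ 2 = \int[mu]_(x in G) (normc (f x) ^+ 2).
Proof. by rewrite sqr_sqrtr// Rintegral_ge0// => x _; exact: sqr_ge0. Qed.

Lemma L2norm1 h : L2inner G h h = 1 -> L2norm G h = 1.
Proof.
move=> h1; rewrite /L2norm -[RHS]sqrtr1; congr Num.sqrt.
have := congr1 (@complex.Re R) h1; rewrite /L2inner/= => <-.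
by apply: eq_Rintegral => x _; rewrite Re_mulconj.
Qed.

Lemma L2norm0 : L2norm G (fun=> 0) = 0.
Proof.
rewrite /L2norm; under eq_Rintegral do rewrite Normc.normc0 expr0n/=.
by rewrite /Rintegral integral0 sqrtr0.
Qed.

(** The Cauchy-Schwarz inequality for a unit vector, from 2 |f| |h| <= |f|^2 / t + t |h|^2.
    Taking t a little above the norm of f avoids a division by zero. *)
Lemma L2inner_le f h : L2 G f -> L2 G h -> L2norm G h = 1 ->
  `|complex.Re (L2inner G f h)| <= L2norm G f.
Proof.
move=> Lf Lh h1; apply/ler_addgt0Pr => eps eps0.
have f0 : 0 <= L2norm G f by exact: sqrtr_ge0.
pose t := L2norm G f + eps; have t0 : 0 < t by rewrite ltr_wpDl.
pose g x := (2 * t)^-1 * normc (f x) ^+ 2 + t / 2 * normc (h x) ^+ 2.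
have ig : mu.-integrable G (EFin \o g).
  by apply: integrable_add; apply: integrable_scale; exact: L2_integrable.
apply: (@le_trans _ _ (\int[mu]_(x in G) g x)).
  apply: (@normr_Rintegral_le_dominated _ _ _ _ _ set0) => //.
    by move=> x _; rewrite addr_ge0// mulr_ge0 ?sqr_ge0 ?invr_ge0 ?divr_ge0 ?mulr_ge0 ?(ltW t0).
  move=> x _ _; apply: (le_trans (normc_ge_absRe _)).
  rewrite Normc.normcM normc_conj /g.
  set a := normc _; set b := normc _.
  rewrite -subr_ge0 (_ : _ - _ = (2 * t)^-1 * (a - t * b) ^+ 2).
    by rewrite mulr_ge0 ?sqr_ge0// invr_ge0 mulr_ge0 ?(ltW t0).
  by field; rewrite gt_eqF.
rewrite RintegralD//; last 2 first.
- exact: integrable_scale (L2_integrable Lf).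
- exact: integrable_scale (L2_integrable Lh).
rewrite !RintegralZl//; [|exact: L2_integrable|exact: L2_integrable].
rewrite -!L2norm_sqr h1 expr1n mulr1 -/t.
have h2 : (2 * t)^-1 * L2norm G f ^+ 2 <= t / 2.
  rewrite ler_pdivrMl ?mulr_gt0// (_ : 2 * t * (t / 2) = t ^+ 2); last by field.
  by apply: lerXn2r; rewrite ?nnegrE ?(ltW t0)// lerDl ltW.
by move: h2; lra.
Qed.
End L2_theory.

Section orthogonal_expansion.
Variables (R : realType) (d : nat) (G : set 'rV[R]_d).
Hypothesis mG : measurable G.
Local Open Scope complex_scope.
Notation mu := (row_lebesgue R d).

(** The partial sums have this inner product with e n as soon as N > n, and the inner
    product is continuous. *)
Lemma Re_L2inner_expansion (e : nat -> 'rV[R]_d -> R[i]) (c : nat -> R[i]) Y n :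
  (forall k, L2 G (e k)) -> (forall k l, L2inner G (e k) (e l) = (k == l)%:R) ->
  L2 G Y -> L2cvg G (fun N x => \sum_(k < N) c k * e k x) Y ->
  complex.Re (L2inner G Y (e n)) = complex.Re (c n).
Proof.
move=> Le oe LY cY.
have en1 : L2norm G (e n) = 1 by apply: L2norm1; rewrite oe eqxx.
have LS N : L2 G (fun x => \sum_(k < N) c k * e k x).
  by apply: (@L2_sum _ _ _ mG N (fun k x => c k * e k x)) => k; exact: L2Z.
apply/eqP; rewrite -subr_eq0 -normr_le0; apply/ler_addgt0Pr => eps eps0.
rewrite add0r.
have [M _ HM] := (cvgr0_norm_lt _ cY) _ eps0.
have := HM (maxn M n.+1) (leq_maxl _ _); set N := maxn M n.+1.
have nN : (n < N)%N by rewrite leq_maxr.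
rewrite ger0_norm ?sqrtr_ge0// => /ltW; apply: le_trans.
apply: le_trans (L2inner_le mG (L2B mG (LS N) LY) (Le n) en1).
rewrite L2innerB// (@L2inner_sum _ _ _ mG N (fun k x => c k * e k x))//; last first.
  by move=> k; exact: L2Z.
rewrite (bigD1 (Ordinal nN))//= L2innerZ// oe eqxx mulr1 big1 ?addr0.
  by rewrite ReB distrC.
move=> k kn; rewrite L2innerZ// oe (_ : (k == n :> nat) = false) ?mulr0//.
by apply/negbTE; apply: contra kn => /eqP kn; apply/eqP/val_inj.
Qed.

(** The expectation commutes with the inner product for the simple functions S k that
    define it, and phi = Re <S k, h> exceeds b by at most the norm of S k - Y, whose integral
    tends to 0. Only the integrals of phi and b are split, as Y may not be measurable. *)
Lemma Re_L2inner_expectation_le dO (Omega : measurableType dO)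
    (P : probability Omega R) (Y : Omega -> 'rV[R]_d -> R[i]) m h (b : Omega -> R) :
  L2_expectation P G Y m -> (forall w, L2 G (Y w)) -> L2 G m ->
  L2 G h -> L2norm G h = 1 -> P.-integrable setT (EFin \o b) ->
  (forall w, complex.Re (L2inner G (Y w) h) <= b w) ->
  complex.Re (L2inner G m h) <= \int[P]_w b w.
Proof.
move=> [N [A [f [mf _ cS cm]]]] LY Lm Lh h1 ib Yb.
apply/ler_addgt0Pr => eps eps0; have e2 : 0 < eps / 2 by rewrite divr_gt0.
have [k1 _ Hk1] := (cvgr0_norm_lt _ cm) _ e2.
have [k2 _ Hk2] : \forall k \near \oo, (\int[P]_w (L2norm G (fun x =>
    \sum_(j < N k) (\1_(A k j) w)%:C * f k j x - Y w x))%:E < (eps / 2)%:E)%E.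
  apply: (cS [set y | (y < (eps / 2)%:E)%E]); apply: open_nbhs_nbhs; split.
    exact: open_ereal_lt_ereal.
  by rewrite /= lte_fin.
pose k := maxn k1 k2.
have {}Hk1 := Hk1 k (leq_maxl _ _); have {}Hk2 := Hk2 k (leq_maxr _ _).
rewrite ger0_norm ?sqrtr_ge0// in Hk1.
pose v j := complex.Re (L2inner G (f k j) h).
have Lf j : L2 G (f k j) by have [] := mf k j.
have mA j : measurable (A k j) by have [] := mf k j.
have LS (a : nat -> R) : L2 G (fun x => \sum_(j < N k) (a j)%:C * f k j x).
  by apply: (@L2_sum _ _ _ mG (N k) (fun j x => (a j)%:C * f k j x)) => j; exact: L2Z.
have IS (a : nat -> R) : complex.Re (L2inner G (fun x => \sum_(j < N k) (a j)%:C * f k j x) h) =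
    \sum_(j < N k) a j * v j.
  rewrite (@L2inner_sum _ _ _ mG (N k) (fun j x => (a j)%:C * f k j x))//; last first.
    by move=> j; exact: L2Z.
  rewrite Re_sum; apply: eq_bigr => j _; rewrite L2innerZ// Re_mul /=.
  by rewrite mul0r subr0.
clearbody v.
pose phi w := \sum_(j < N k) (\1_(A k j) w : R) * v j.
have iphij j : P.-integrable setT (EFin \o (fun w => (\1_(A k j) w : R) * v j)).
  have iA : P.-integrable setT (EFin \o (\1_(A k j) : Omega -> R)).
    by apply: integrable_indic => //; rewrite (le_lt_trans (probability_le1 _ _))// ltry.
  by have := integrableZr measurableT (v j) iA.
have iphi : P.-integrable setT (EFin \o phi).
  rewrite (_ : _ \o _ = (fun w => \sum_(j < N k) ((\1_(A k j) w : R) * v j)%:E)%E).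
    apply: integrable_sum => // j _; exact: iphij.
  by apply/funext => w /=; rewrite sumEFin.
have Ephi : \int[P]_w phi w = \sum_(j < N k) fine (P (A k j)) * v j.
  rewrite /Rintegral (_ : (fun w => _) = (fun w => \sum_(j < N k) ((\1_(A k j) w : R) * v j)%:E)%E).
    rewrite integral_sum//; last by move=> j; exact: iphij.
    rewrite (eq_bigr (fun j : 'I_(N k) => (fine (P (A k j)) * v j)%:E)) ?sumEFin// => j _.
    under eq_integral do rewrite EFinM.
    rewrite integralZr//; last first.
      by apply: integrable_indic => //; rewrite (le_lt_trans (probability_le1 _ _))// ltry.
    by rewrite integral_indic// setIT EFinM fineK// fin_num_measure.
  by apply/funext => w /=; rewrite sumEFin.
have phib w : phi w - b w <= L2norm G (fun x =>
    \sum_(j < N k) (\1_(A k j) w)%:C * f k j x - Y w x).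
  have LSw := LS (fun j => \1_(A k j) w).
  apply: le_trans (le_trans (ler_norm _) (L2inner_le mG (L2B mG LSw (LY w)) Lh h1)).
  rewrite (L2innerB mG LSw (LY w) Lh) ReB (IS (fun j => \1_(A k j) w)) -/(phi w).
  by rewrite lerD2l lerN2.
have int_le : \int[P]_w phi w - \int[P]_w b w <= eps / 2.
  rewrite -RintegralB// -lee_fin.
  rewrite /Rintegral fineK; last first.
    by apply: integrable_fin_num => //; exact: (integrableB measurableT iphi ib).
  apply: le_trans (ltW Hk2).
  pose q : Omega -> \bar R := EFin \o (fun w => phi w - b w).
  have iq : P.-integrable setT q by exact: (integrableB measurableT iphi ib).
  apply: (@le_trans _ _ (\int[P]_w (q^\+ w))%E).
    apply: le_integral => //; first exact: integrable_funepos.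
    by move=> w _; rewrite funeposE le_max lexx.
  apply: ge0_le_integral_nomeas => // w _.
  by rewrite funeposE/= -EFin_max lee_fin ge_max sqrtr_ge0 andbT; exact: phib.
have m_le : complex.Re (L2inner G m h) <= \int[P]_w phi w + eps / 2.
  have LSP := LS (fun j => fine (P (A k j))).
  have := le_trans (L2inner_le mG (L2B mG LSP Lm) Lh h1) (ltW Hk1).
  rewrite ler_norml => /andP[+ _].
  rewrite (L2innerB mG LSP Lm Lh) ReB (IS (fun j => fine (P (A k j)))) -Ephi.
  by lra.
by move: int_le m_le; lra.
Qed.
End orthogonal_expansion.

(** * Bounds on the coefficients of the solution *)

Section control_bounds.
Variables (R : realType) (d : nat) (alpha T : R) (G G0 : set 'rV[R]_d).
Variables (lambda : nat -> R) (e : nat -> 'rV[R]_d -> R[i]).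
Hypothesis T0 : 0 < T.
Hypotheses (mG : measurable G) (Goo : (row_lebesgue R d G < +oo)%E).
Hypotheses (Le : forall n, L2 G (e n)) (e1 : forall n, L2norm G (e n) = 1).
Local Open Scope complex_scope.
Notation normc := (@Normc.normc R).
Notation mu := (row_lebesgue R d).
Notation leb := (@lebesgue_measure R).

Lemma Rintegral_L2_1 n : \int[mu]_(x in G) (normc (e n x) ^+ 2) = 1.
Proof. by rewrite -L2norm_sqr e1 expr1n. Qed.

(** By Fubini, for almost every s the bound |u(s, .)| <= C holds almost everywhere on G0.
    Then |<1_G0 u(s, .), e_n>| is at most C times the integral of |e_n| over G, and
    |e_n| <= (1 + |e_n|^2) / 2 makes this independent of n. The real and the imaginary part
    contribute one half of the bound each. *)
Lemma control_inner_bound (u : R * 'rV[R]_d -> R[i]) (C : R) : 0 <= C ->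
  (control_norm T G0 u <= C%:E)%E ->
  exists N : set R, [/\ measurable N, leb N = 0%E &
    forall s n, 0 < s < T -> ~ N s ->
      normc (control_inner G G0 e u s n) <= C * (1 + fine (mu G))].
Proof.
move=> C0 /ess_supP [N [mN N0 subN]].
have mx : measurable_fun (setT : set R) (fun s => mu (xsection N s)).
  exact: measurable_fun_xsection.
have [M [mM M0 subM]] : ae_eq leb setT (fun s => mu (xsection N s)) (cst 0%E).
  apply/ae_eq_integral_abs => //.
  by under eq_integral do rewrite gee0_abs//.
exists M; split => // s n /andP[s0 sT] Ms.
have Ns0 : mu (xsection N s) = 0%E.
  by apply: contrapT => h; apply: Ms; apply: subM => /= H; apply: h; exact: H.
have mNs : measurable (xsection N s) by exact: measurable_xsection.
have bnd x : G x -> ~ xsection N s x -> normc ((\1_G0 x)%:C * u (s, x) * conjc (e n x)) <=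
    C / 2 * (1 + normc (e n x) ^+ 2).
  move=> Gx Nx.
  have : normc (u (s, x)) * \1_(`]0%R, T[%classic `*` G0) (s, x) <= C.
    rewrite -lee_fin; apply: contrapT => h; apply: Nx.
    by rewrite /xsection/= inE; exact: subN.
  rewrite !Normc.normcM normc_conj normc_real !indicE.
  rewrite (_ : ((s, x) \in _) = (x \in G0)); last first.
    apply/idP/idP; rewrite !inE/= ?in_itv/=; first by case.
    by move=> ?; split => //; rewrite s0.
  rewrite ger0_norm// mulrC => h; apply: (le_trans (ler_wpM2r (normc_ge0 _) h)).
  rewrite -mulrA ler_wpM2l//.
  have := sqr_ge0 (normc (e n x) - 1); rewrite sqrrB expr1n mulr1; lra.
have i1 : mu.-integrable G (EFin \o (fun=> 1 : R)).
  apply/integrableP; split; first exact/measurable_EFinP/measurable_cst.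
  by under eq_integral do rewrite /= normr1; rewrite integral_cst// mul1e.
have i2 : mu.-integrable G (EFin \o (fun x => 1 + normc (e n x) ^+ 2)).
  by have := integrableD mG i1 (L2_integrable (Le n)).
have ig : mu.-integrable G (EFin \o (fun x => C / 2 * (1 + normc (e n x) ^+ 2))).
  by have := integrableZl mG (C / 2) i2.
have Ig : \int[mu]_(x in G) (C / 2 * (1 + normc (e n x) ^+ 2)) = C / 2 * (1 + fine (mu G)).
  rewrite RintegralZl// RintegralD//; last exact: L2_integrable.
  by rewrite Rintegral_L2_1 Rintegral_cst// mul1r addrC.
have g0 x : G x -> 0 <= C / 2 * (1 + normc (e n x) ^+ 2).
  by move=> _; rewrite mulr_ge0 ?divr_ge0 ?addr_ge0 ?sqr_ge0.
have hRe := normr_Rintegral_le_dominated mG mNs Ns0 ig g0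
  (fun x Gx Nx => le_trans (normc_ge_absRe _) (bnd x Gx Nx)).
have hIm := normr_Rintegral_le_dominated mG mNs Ns0 ig g0
  (fun x Gx Nx => le_trans (normc_ge_absIm _) (bnd x Gx Nx)).
rewrite Ig in hRe hIm.
apply: (le_trans (normc_le_ReIm _)); rewrite /control_inner /L2inner /=.
by move: hRe hIm; lra.
Qed.

(** The memory kernel enters only through a majorant A r `^ (b - 1), whose integral over
    ]0, T[ is explicit. *)
Lemma solution_coef_le (u : R * 'rV[R]_d -> R[i]) (N : set R) (K A b xi : R) n :
  measurable N -> leb N = 0%E -> 0 <= K -> 0 <= A -> 0 < b ->
  (forall s, 0 < s < T -> ~ N s -> normc (control_inner G G0 e u s n) <= K) ->
  (forall r, 0 < r < T -> r `^ (alpha - 1) *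
      normc (mittag_leffler alpha alpha (- ('i * (xi * lambda n * r `^ alpha)%:C)))
     <= A * r `^ (b - 1)) ->
  `|complex.Re (solution_coef alpha G G0 lambda e xi (fun=> 0) u T n)| <=
    K * A * (T `^ b / b).
Proof.
move=> mN N0 K0 A0 b0 hK hA.
have ig0 : leb.-integrable `]0%R, T[ (fun s : R => ((T - s) `^ (b - 1))%:E).
  apply/integrableP; split.
    apply/measurable_EFinP/measurable_funTS.
    apply: (@measurableT_comp _ _ _ _ _ _ (fun x : R => x `^ (b - 1))).
      exact: measurable_powR.
    exact: measurable_funB.
  under eq_integral do rewrite gee0_abs ?lee_fin ?powR_ge0//.
  by rewrite integral_powR_rev// ltry.
have mI : measurable (`]0%R, T[%classic : set R) by exact: measurable_itv.
have ig : leb.-integrable `]0%R, T[ (EFin \o (fun s : R => K * A * (T - s) `^ (b - 1))).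
  by have := @integrableZl _ _ _ leb _ mI (K * A) _ ig0.
have Ig : \int[leb]_(s in `]0%R, T[) (K * A * (T - s) `^ (b - 1)) = K * A * (T `^ b / b).
  by rewrite RintegralZl// /Rintegral integral_powR_rev.
rewrite -Ig /solution_coef L2inner0 mul0r add0r.
pose F (s : R) : R[i] := control_inner G G0 e u s n * ((T - s) `^ (alpha - 1))%:C *
  mittag_leffler alpha alpha (- ('i * (xi * lambda n * (T - s) `^ alpha)%:C)).
have HF s : 0 < s < T -> ~ N s -> normc (F s) <= K * A * (T - s) `^ (b - 1).
  move=> sT Ns; rewrite /F !Normc.normcM normc_real ger0_norm ?powR_ge0//.
  rewrite -[leLHS]mulrA -[leRHS]mulrA.
  apply: ler_pM; rewrite ?mulr_ge0 ?normc_ge0 ?powR_ge0//; first exact: hK.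
  by case/andP: sT => s0 sT; apply: hA; rewrite subr_gt0 sT ltrBlDr ltrDl.
have HR s : `]0%R, T[%classic s -> ~ N s -> `|complex.Re (F s)| <= K * A * (T - s) `^ (b - 1).
  move=> sI Ns; apply: le_trans (normc_ge_absRe _) (HF _ _ Ns).
  by move: sI; rewrite /= in_itv.
change (`|\int[leb]_(s in `]0%R, T[) complex.Re (F s)| <=
  \int[leb]_(s in `]0%R, T[) (K * A * (T - s) `^ (b - 1))).
apply: (@normr_Rintegral_le_dominated _ _ _ leb _ N) => //.
by move=> s _; rewrite !mulr_ge0 ?powR_ge0.
Qed.
End control_bounds.

Section noncontrollability.
Variable R : realType.
Local Open Scope complex_scope.
Notation normc := (@Normc.normc R).

(** Continuity of P from above: the sets decrease to the event xi = 0, which has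
    probability 0 because xi has a density. *)
Lemma small_ball_probability dO (Omega : measurableType dO) (P : probability Omega R)
    (xi : {RV P >-> R}) (eps : R) : absolutely_continuous_rv xi -> 0 < eps ->
  exists2 dl : R, 0 < dl & (P [set w | (`|xi w| <= dl)%R] < eps%:E)%E.
Proof.
move=> [rho [rho0 irho Prho]] eps0.
pose F k : set Omega := [set w | `|xi w| <= k.+1%:R^-1].
have mF k : measurable (F k).
  rewrite (_ : F k = xi @^-1` `[- k.+1%:R^-1, k.+1%:R^-1]%classic); last first.
    by apply/seteqP; split => w; rewrite /F/= in_itv/= ler_norml.
  by rewrite -[X in measurable X]setTI; apply: measurable_funPT => //; exact: measurable_itv.
have F0 : \bigcap_k F k = xi @^-1` [set 0].
  apply/seteqP; split => w /=.
    move=> Fw; apply/eqP; rewrite -normr_le0; apply/ler_addgt0Pr => e e0.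
    rewrite add0r; pose k := Num.truncn e^-1.
    apply: (le_trans (Fw k I)).
    by rewrite invf_ple ?posrE// ltW// truncnS_gt.
  by move=> /= w0 k _; rewrite /F/= w0 normr0 invr_ge0.
have P0 : P (xi @^-1` [set 0]) = 0%E.
  by rewrite Prho// integral_set1.
have cP : P (F k) @[k --> \oo] --> 0%E.
  rewrite -P0 -F0; apply: nonincreasing_cvg_mu => //.
  - by rewrite (le_lt_trans (probability_le1 _ _))// ltry.
  - exact: bigcapT_measurable.
  - move=> m n mn; apply/subsetPset => w /= /le_trans; apply.
    by rewrite lef_pV2 ?posrE// ler_nat.
have [k _ Hk] : \forall k \near \oo, (P (F k) < eps%:E)%E.
  apply: (cP [set y | (y < eps%:E)%E]); apply: open_nbhs_nbhs; split.
    exact: open_ereal_lt_ereal.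
  by rewrite /= lte_fin.
by exists k.+1%:R^-1; rewrite ?invr_gt0//; exact: Hk (leqnn k).
Qed.

(** Of the decay 1 / |y| only the square root is used (the geometric mean of the two
    bounds): it gains L^(-1/2) and costs r `^ (- alpha / 2), which keeps the kernel
    integrable at 0. *)
Lemma mittag_leffler_kernel_decay (alpha B L c r : R) : 0 < B -> 0 < r ->
  (forall y : R, normc (mittag_leffler alpha alpha (- ('i * y%:C))) <= B /\
    `|y| * normc (mittag_leffler alpha alpha (- ('i * y%:C))) <= B) ->
  0 < L -> L <= `|c| ->
  r `^ (alpha - 1) * normc (mittag_leffler alpha alpha (- ('i * (c * r `^ alpha)%:C)))
    <= B / Num.sqrt L * r `^ (alpha / 2 - 1).
Proof.
move=> B0 r0 HB L0 Lc; have [h1 h2] := HB (c * r `^ alpha).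
move: h1 h2; set a := normc _ => h1 h2.
have a0 : 0 <= a by exact: normc_ge0.
pose p := r `^ (alpha / 2); have p0 : 0 < p by rewrite powR_gt0.
have pp : r `^ alpha = p ^+ 2.
  by rewrite -powR_mulrn ?powR_ge0// -powRrM divfK.
pose q := r `^ (alpha / 2 - 1).
have qp : r `^ (alpha - 1) = q * p.
  rewrite /q /p -powRD; last by rewrite (gt_eqF r0) implybT.
  by congr (r `^ _); field.
have sL : 0 < Num.sqrt L by rewrite sqrtr_gt0.
have key : Num.sqrt L * p * a <= B.
  have : (Num.sqrt L * p * a) ^+ 2 <= B ^+ 2.
    rewrite !exprMn sqr_sqrtr ?(ltW L0)// -pp.
    apply: (@le_trans _ _ (`|c * r `^ alpha| * a * a)).
      rewrite -mulrA expr2 !mulrA ler_wpM2r// ler_wpM2r// normrM.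
      by rewrite [`|_ `^ _|]ger0_norm ?powR_ge0// ler_wpM2r ?powR_ge0.
    by rewrite expr2; apply: ler_pM => //; rewrite mulr_ge0.
  rewrite ler_pXn2r// nnegrE ?(ltW B0)// !mulr_ge0// ?(ltW p0) ?(ltW sL)//.
rewrite qp -/q [leRHS]mulrAC ler_pdivlMr//.
rewrite [leLHS](_ : _ = q * (Num.sqrt L * p * a)); last by ring.
by rewrite [leRHS]mulrC ler_wpM2l// powR_ge0.
Qed.
End noncontrollability.

(** * Lack of exact averaged controllability *)

Theorem corollary4p2 (R : realType) (d : nat) (alpha T : R)
    (G G0 : set 'rV[R]_d.+1)
    (lambda : nat -> R) (e : nat -> 'rV[R]_d.+1 -> R[i])
    (dO : measure_display) (Omega : measurableType dO) (P : probability Omega R)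
    (xi : {RV P >-> R})
    (halpha : 0 < alpha < 1) (hT : 0 < T)
    (hG : bounded_lipschitz_domain G)
    (hG0 : G0 `<=` G) (hG0pos : positive_lebesgue_measurable G0)
    (hbasis : dirichlet_eigenbasis G lambda e)
    (hxi : absolutely_continuous_rv xi) :
  ~ exactly_averaged_controllable alpha T G G0 lambda e xi.
Proof.
move=> [C [C0 HC]].
have [oG _ _ bG _] := hG.
have mG : measurable G by exact: row_open_measurable.
have Goo := row_bounded_lty mG bG.
have [_ _ lambdaoo [Le oe _] _] := hbasis.
have e1 n : L2norm G (e n) = 1 by apply: L2norm1; rewrite oe eqxx.
have [B B0 HB] := mittag_leffler_imag_bound halpha.
have a0 : 0 < alpha by case/andP: halpha.
have a20 : 0 < alpha / 2 by rewrite divr_gt0.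
pose K := C * (1 + fine (row_lebesgue R d.+1 G)).
have K0 : 0 <= K by rewrite mulr_ge0 ?(ltW C0)// addr_ge0// fine_ge0.
pose K1 := K * B * (T `^ alpha / alpha).
pose K2 := K * B * (T `^ (alpha / 2) / (alpha / 2)).
have KB0 : 0 <= K * B by apply: mulr_ge0 => //; exact: ltW.
have K10 : 0 <= K1 by apply: mulr_ge0 => //; rewrite divr_ge0 ?powR_ge0 ?(ltW a0).
have K20 : 0 <= K2 by apply: mulr_ge0 => //; rewrite divr_ge0 ?powR_ge0 ?(ltW a20).
have eps0 : 0 < (2 * (K1 + 1))^-1 by rewrite invr_gt0 mulr_gt0// ltr_wpDl.
have [dl dl0 Hdl] := small_ball_probability hxi eps0.
pose A : set Omega := [set w | `|xi w| <= dl].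
have mA : measurable A.
  rewrite (_ : A = xi @^-1` `[- dl, dl]%classic); last first.
    by apply/seteqP; split => w; rewrite /A/= in_itv/= ler_norml.
  by rewrite -[X in measurable X]setTI; apply: measurable_funPT => //; exact: measurable_itv.
(* steering 0 to e n with cost C *)
have main n : 0 < lambda n ->
    1 <= K1 * fine (P A) + K2 / Num.sqrt (dl * lambda n).
  move=> ln0.
  have [u [_ hu [Y [HY EY]]]] := HC (fun=> 0) (e n) (L2_0 G) (Le n).
  rewrite L2norm0 e1 add0r mulr1 in hu.
  have [N [mN N0 HN]] := control_inner_bound mG Goo Le e1 (ltW C0) hu.
  have LY w : L2 G (Y w) by have [] := HY w.
  pose b w : R := K1 * \1_A w + K2 / Num.sqrt (dl * lambda n).
  have L0 : 0 < dl * lambda n by rewrite mulr_gt0.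
  have Yb w : complex.Re (L2inner G (Y w) (e n)) <= b w.
    have [_ cY] := HY w.
    rewrite (Re_L2inner_expansion mG n Le oe (LY w) cY).
    apply: (le_trans (ler_norm _)).
    have HN' s : 0 < s < T -> ~ N s -> _ := HN s n.
    rewrite /b indicE; case: (boolP (w \in A)) => [_|].
      rewrite mulr1; apply: ler_wpDr; first by rewrite divr_ge0 ?sqrtr_ge0.
      apply: (solution_coef_le _ mN N0 K0 (ltW B0) a0 HN') => // r /andP[r0 _].
      by rewrite mulrC ler_wpM2r ?powR_ge0//; have [] := HB (xi w * lambda n * r `^ alpha).
    rewrite notin_setE /A/= => /negP; rewrite -ltNge => xidl.
    rewrite mulr0 add0r.
    have Lc : dl * lambda n <= `|xi w * lambda n|.
      by rewrite normrM (gtr0_norm ln0) ler_wpM2r// ltW.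
    have -> : K2 / Num.sqrt (dl * lambda n) =
        K * (B / Num.sqrt (dl * lambda n)) * (T `^ (alpha / 2) / (alpha / 2)).
      by rewrite /K2 !mulrA; ring.
    have BL0 : 0 <= B / Num.sqrt (dl * lambda n) by rewrite divr_ge0 ?sqrtr_ge0 ?(ltW B0).
    apply: (solution_coef_le _ mN N0 K0 BL0 a20 HN') => // r /andP[r0 _].
    exact: mittag_leffler_kernel_decay.
  have iA : P.-integrable setT (EFin \o (fun w => K1 * \1_A w)).
    have iA1 : P.-integrable setT (EFin \o (\1_A : Omega -> R)).
      by apply: integrable_indic => //; rewrite (le_lt_trans (probability_le1 _ _))// ltry.
    by have := integrableZl measurableT K1 iA1.
  have ic : P.-integrable setT (EFin \o (fun=> K2 / Num.sqrt (dl * lambda n))).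
    exact: finite_measure_integrable_cst.
  have ib : P.-integrable setT (EFin \o b) by have := integrableD measurableT iA ic.
  have := Re_L2inner_expectation_le mG EY LY (Le n) (Le n) (e1 n) ib Yb.
  rewrite oe eqxx /= => /le_trans; apply.
  rewrite RintegralD// RintegralZl//; last first.
    by apply: integrable_indic => //; rewrite (le_lt_trans (probability_le1 _ _))// ltry.
  have -> : \int[P]_w \1_A w = fine (P A) by rewrite /Rintegral integral_indic// setIT.
  have -> : \int[P]_(_ in setT) (K2 / Num.sqrt (dl * lambda n)) = K2 / Num.sqrt (dl * lambda n).
    have PT : fine (P setT) = 1 by have := @probability_setT _ _ _ P => /= ->.
    by rewrite (Rintegral_cst P measurableT) PT mulr1.
  by [].
have PA : K1 * fine (P A) <= 2^-1.
  have PAfin : P A \is a fin_num by exact: fin_num_measure.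
  have : fine (P A) <= (2 * (K1 + 1))^-1 by rewrite -lee_fin fineK// ltW.
  move=> h; apply: (le_trans (ler_wpM2l K10 h)).
  rewrite ler_pdivrMr; last by rewrite mulr_gt0// ltr_wpDl.
  by rewrite mulrA mulVf// mul1r lerDl.
have [n [ln0 Hn]] : exists n, 0 < lambda n /\ K2 / Num.sqrt (dl * lambda n) < 2^-1.
  pose M := ((2 * K2 + 1) ^+ 2) / dl.
  have [n _ Hn] : \forall n \near \oo, M < lambda n.
    by move/cvgryPgt : lambdaoo; apply.
  have := Hn _ (leqnn n); rewrite /M ltr_pdivrMr// => hM.
  have q0 : 0 < 2 * K2 + 1 by rewrite ltr_wpDl// mulr_ge0.
  have ln0 : 0 < lambda n.
    by rewrite -(pmulr_lgt0 _ dl0); apply: lt_trans hM; rewrite exprn_gt0.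
  exists n; split => //.
  have hs : 2 * K2 + 1 <= Num.sqrt (dl * lambda n).
    rewrite -[leLHS]ger0_norm ?(ltW q0)// -sqrtr_sqr ler_sqrt ?mulr_ge0 ?(ltW dl0) ?(ltW ln0)//.
    by rewrite [dl * _]mulrC ltW.
  have s0 : 0 < Num.sqrt (dl * lambda n) by apply: lt_le_trans hs.
  rewrite ltr_pdivrMr// mulrC ltr_pdivlMr// mulrC.
  by apply: lt_le_trans hs; rewrite ltrDl.
by have := main n ln0; move: PA Hn; lra.
Qed.
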